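(* Unless the Exponential Time Hypothesis fails, Offensive Alliance cannot be solved in time $\mathcal{O}^{*}(2^{o(k\log k)})$, where $k$ is the solution size (the size bound $r$ in the instance).
   Context: All graphs are finite, simple and undirected. For $S\subseteq V(G)$, $N(S)$ is the open neighbourhood of $S$, $S^c=V(G)\setminus S$, and $d_S(v)$ is the number of neighbours of $v$ in $S$. A non-empty set $S\subseteq V(G)$ is an offensive alliance if $d_S(v)\ge d_{S^c}(v)+1$ for every $v\in N(S)$. Offensive Alliance: given a graph $G$ and integer $r\ge 1$, is there an offensive alliance $S$ with $1\le |S|\le r$? The notation $\mathcal{O}^*$ suppresses factors polynomial in the input size. *)

(* Defs.v *)
From HB Require Import structures.
From mathcomp Require Import all_boot all_order all_algebra.
From mathcomp Require Import all_classical all_reals all_analysis.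

Set Implicit Arguments.
Unset Strict Implicit.
Unset Printing Implicit Defensive.

Import Order.TTheory GRing.Theory Num.Theory.
Local Open Scope ring_scope.

(** * Model of computation *)

(* Unit-cost RAM in structured form: registers and an indirectly addressable
   memory, all holding natural numbers of arbitrary size. The only arithmetic
   operations are addition and truncated subtraction; in particular there is no
   unit-cost multiplication, so that running times are polynomially related to
   those of Turing machines. *)
Inductive cmd : Type :=
  | Skip
  | Const of nat & nat           (* reg i := c *)
  | Add of nat & nat & nat       (* reg i := reg j + reg k *)
  | Sub of nat & nat & nat       (* reg i := reg j - reg k, truncated at 0 *)
  | Read of nat & nat            (* reg i := mem[reg j] *)
  | Write of nat & nat           (* mem[reg i] := reg j *)
  | Seq of cmd & cmd
  | If of nat & cmd & cmd        (* the test is reg i <> 0 *)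
  | While of nat & cmd.          (* the test is reg i <> 0 *)

Record state := State { reg : nat -> nat; memory : nat -> nat }.

Definition upd (f : nat -> nat) (i v : nat) : nat -> nat :=
  fun j => if j == i then v else f j.

Definition set_reg (s : state) (i v : nat) : state :=
  State (upd (reg s) i v) (memory s).

Definition set_mem (s : state) (a v : nat) : state :=
  State (reg s) (upd (memory s) a v).

(* exec c s t s': c started in state s halts in state s' after exactly t steps;
   every basic instruction and every test counts as one step. *)
Inductive exec : cmd -> state -> nat -> state -> Prop :=
  | ExecSkip s : exec Skip s 1 s
  | ExecConst s i c : exec (Const i c) s 1 (set_reg s i c)
  | ExecAdd s i j k :
      exec (Add i j k) s 1 (set_reg s i (reg s j + reg s k)%N)
  | ExecSub s i j k :
      exec (Sub i j k) s 1 (set_reg s i (reg s j - reg s k)%N)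
  | ExecRead s i j : exec (Read i j) s 1 (set_reg s i (memory s (reg s j)))
  | ExecWrite s i j : exec (Write i j) s 1 (set_mem s (reg s i) (reg s j))
  | ExecSeq c1 c2 s s1 s2 t1 t2 :
      exec c1 s t1 s1 -> exec c2 s1 t2 s2 -> exec (Seq c1 c2) s (t1 + t2)%N s2
  | ExecIfT i c1 c2 s s' t :
      reg s i != 0%N -> exec c1 s t s' -> exec (If i c1 c2) s t.+1 s'
  | ExecIfF i c1 c2 s s' t :
      reg s i = 0%N -> exec c2 s t s' -> exec (If i c1 c2) s t.+1 s'
  | ExecWhileT i c s s1 s2 t1 t2 :
      reg s i != 0%N -> exec c s t1 s1 -> exec (While i c) s1 t2 s2 ->
      exec (While i c) s (t1 + t2).+1 s2
  | ExecWhileF i c s : reg s i = 0%N -> exec (While i c) s 1 s.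

(* The input word occupies memory cells 0, 1, ...; its length is in register 0;
   all other cells and registers are 0. *)
Definition init_state (w : seq nat) : state :=
  State (upd (fun=> 0%N) 0 (size w)) (nth 0%N w).

Definition accepting (s : state) : bool := reg s 0 != 0%N.

(* Total number of binary digits. *)
Definition bit_size (w : seq nat) : nat :=
  (\sum_(a <- w) (trunc_log 2 a).+1)%N.

Record problem := Problem {
  instance : Type;
  yes_instance : instance -> Prop;
  encode : instance -> seq nat }.

Definition solves_within (R : realType) (P : problem) (c : cmd)
    (T : instance P -> R) : Prop :=
  forall x : instance P, exists (t : nat) (s : state),
    [/\ exec c (init_state (encode x)) t s,
        (t%:R <= T x)%R
      & accepting s <-> yes_instance x].

Definition solvable_Ostar (R : realType) (P : problem)
    (g : instance P -> R) : Prop :=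
  exists (c : cmd) (d : nat),
    solves_within c
      (fun x : instance P => g x * (d * (bit_size (encode x)).+1 ^ d)%:R).

(** * The Exponential Time Hypothesis *)

(* (i, true) is the variable i and (i, false) is its negation. *)
Definition literal (n : nat) : Type := ('I_n * bool)%type.

(* The three literals need not be distinct, so shorter clauses are included. *)
Definition clause3 (n : nat) : Type :=
  (literal n * literal n * literal n)%type.

Record cnf3 := CNF3 { nvars : nat; clauses : seq (clause3 nvars) }.

Definition lit_true (n : nat) (a : 'I_n -> bool) (l : literal n) : bool :=
  a l.1 == l.2.

Definition clause_true (n : nat) (a : 'I_n -> bool) (C : clause3 n) : bool :=
  [|| lit_true a C.1.1, lit_true a C.1.2 | lit_true a C.2].

Definition satisfiable (phi : cnf3) : Prop :=
  exists a : 'I_(nvars phi) -> bool, all (clause_true a) (clauses phi).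

Definition lit_code (n : nat) (l : literal n) : nat := ((val l.1).*2 + l.2)%N.

Definition encode_cnf3 (phi : cnf3) : seq nat :=
  nvars phi :: size (clauses phi) ::
  flatten [seq [:: lit_code C.1.1; lit_code C.1.2; lit_code C.2]
          | C <- clauses phi].

Definition SAT3 : problem := Problem satisfiable encode_cnf3.

(* Equivalently, the infimum of the delta > 0 for which 3-SAT is solvable in
   time O*(2^(delta n)), with n the number of variables, is positive. *)
Definition ETH (R : realType) : Prop :=
  exists2 delta : R, 0 < delta &
    ~ solvable_Ostar (P := SAT3)
        (fun phi : cnf3 => 2 `^ (delta * (nvars phi)%:R)).

(** * Offensive alliances *)

Record sgraph (T : finType) := SGraph {
  edge :> rel T;
  edge_sym : symmetric edge;
  edge_irr : irreflexive edge }.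

Definition degree_in (T : finType) (G : sgraph T) (S : {set T}) (v : T) : nat :=
  #|[set u in S | G v u]|.

(* As usual for alliances, N(S) does not contain vertices of S: the "+ 1" in the
   definition of an offensive alliance accounts for v itself, which lies
   outside S. *)
Definition open_nbhd (T : finType) (G : sgraph T) (S : {set T}) : {set T} :=
  [set v | (v \notin S) && [exists u in S, G u v]].

Definition offensive_alliance (T : finType) (G : sgraph T) (S : {set T})
    : Prop :=
  S != finset.set0 /\
  forall v : T, v \in open_nbhd G S ->
    (degree_in G S v >= degree_in G (finset.setC S) v + 1)%N.

Record oa_instance := OAInstance {
  oa_order : nat;
  oa_graph : sgraph 'I_oa_order;
  oa_bound : nat;
  oa_bound_ge1 : (1 <= oa_bound)%N }.

Definition oa_yes (x : oa_instance) : Prop :=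
  exists S : {set 'I_(oa_order x)},
    offensive_alliance (oa_graph x) S /\ (1 <= #|S| <= oa_bound x)%N.

(* Order, size bound, and adjacency matrix in row-major order. *)
Definition encode_oa (x : oa_instance) : seq nat :=
  oa_order x :: oa_bound x ::
  [seq nat_of_bool (oa_graph x u v)
  | u <- enum 'I_(oa_order x), v <- enum 'I_(oa_order x)].

Definition OffensiveAlliance : problem := Problem oa_yes encode_oa.

(* Main.v *)
Require Import Defs.
From HB Require Import structures.
From mathcomp Require Import all_boot all_order all_algebra.
From mathcomp Require Import all_classical all_reals all_analysis.
From mathcomp Require Import zify ring lra.

Set Implicit Arguments.
Unset Strict Implicit.
Unset Printing Implicit Defensive.

Import Order.TTheory GRing.Theory Num.Theory.
Import numFieldNormedType.Exports.

(** Let L be the least positive integer with n <= L 2^L, and put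
    k = 2^L, so that k log k = O(n). Cut the n variables of a 3-CNF formula into
    k groups of L variables; each group has k assignments. The formula is
    satisfiable iff one can select one assignment per group such that every
    clause contains a literal made true by a selected assignment: a hitting set
    problem with k groups of k elements, without any sparsification of the
    formula.

    For the alliance, let M = 3k. Every constraint (a group or a clause) is a
    vertex adjacent to M special vertices, to the at most M elements that satisfy
    it, and to some vertices of a clique of size 8k+2 that bring its degree to
    2M+1. An alliance of size at most r = 4k contains no vertex of the clique and
    no neighbour of one, because the clique vertices outside the alliance have
    degree above 2r. Hence it consists of special vertices and elements; summing
    the inequalities of the group constraints, it contains all special vertices
    and exactly one element of each group, and the inequality of a clause says
    that one of them satisfies the clause.

    The reduction runs in polynomial time in n and the number of clauses, and
    factors polynomial in n are absorbed by 2^(delta n). *)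

(** * Straight-line expressions and loops on the RAM *)

Lemma updE f i v j : upd f i v j = if j == i then v else f j.
Proof. by []. Qed.

Definition agree (D : nat) (s s1 : state) : Prop :=
  (forall j, j < D -> reg s1 j = reg s j) /\ memory s1 = memory s.

Lemma agree_refl D s : agree D s s.
Proof. by split. Qed.

Lemma agree_trans D D1 s s1 s2 :
  D <= D1 -> agree D s s1 -> agree D1 s1 s2 -> agree D s s2.
Proof.
move=> leD [r1 m1] [r2 m2]; split; last by rewrite m2.
by move=> j ltj; rewrite r2 ?r1 //; apply: leq_trans leD.
Qed.

Lemma agree_set_reg D s s1 i v :
  D <= i -> agree D s s1 -> agree D s (set_reg s1 i v).
Proof.
move=> leD [r m]; split=> //= j ltj; rewrite /upd.
by case: eqP => [ji|_]; [lia | apply: r].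
Qed.

(* An expression [e] is compiled to a command [e d] that leaves its value in
   register [d], treats the registers above [d] as a stack, and changes neither
   the registers below [d] nor the memory. [evaluates X e D s v p] says that, in
   every state that agrees with [s] on the memory and the registers below [D],
   the value of [e] is [v] and is found in at most [X ^ p] steps. *)
Definition evaluates (X : nat) (e : nat -> cmd) (D : nat) (s : state) (v p : nat) :=
  forall d s1, D <= d -> agree D s s1 ->
  exists t s2, [/\ exec (e d) s1 t s2, t <= X ^ p, reg s2 d = v & agree d s1 s2].

Lemma ev_weaken X e D D1 s s1 v p :
  evaluates X e D s v p -> D <= D1 -> agree D s s1 -> evaluates X e D1 s1 v p.
Proof.
move=> ve leD ag d s2 led ag2; apply: ve; first exact: leq_trans led.
exact: agree_trans ag2.
Qed.

Lemma ev_exponent X e D s v p q :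
  0 < X -> p <= q -> evaluates X e D s v p -> evaluates X e D s v q.
Proof.
move=> X0 lepq ve d s1 led ag; have [t [s2 [ex let_ rv ag2]]] := ve d s1 led ag.
by exists t, s2; split=> //; apply: leq_trans let_ _; rewrite leq_pexp2l.
Qed.

(** Running times are bounded by powers of a scale [X] of at least 2, so that composing commands
    only adds exponents; the extra [X ^ 2] absorbs additive constants. *)
Lemma leq_add_pow X a b c :
  1 < X -> a <= X ^ b -> c <= X -> a + c <= X ^ (b + 2).
Proof.
move=> X1 ab cX; rewrite expnD.
have A0 : 0 < X ^ b by rewrite expn_gt0; lia.
have -> : X ^ 2 = X * X by [].
have := leq_mul (leqnn (X ^ b * X)) X1; rewrite mulnA.
have := leq_pmull X A0; have := leq_pmulr (X ^ b) (ltnW X1); lia.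
Qed.

Lemma leq_powD X a b p q :
  1 < X -> a <= X ^ p -> b <= X ^ q -> a + b + 1 <= X ^ (p + q + 2).
Proof.
move=> X1 ap bq; rewrite !expnD.
have A0 : 0 < X ^ p by rewrite expn_gt0; lia.
have B0 : 0 < X ^ q by rewrite expn_gt0; lia.
have X4 : 4 <= X ^ 2 by rewrite (@leq_exp2r 2 X 2).
have := leq_mul (leqnn (X ^ p * X ^ q)) X4.
have := leq_pmull (X ^ q) A0; have := leq_pmulr (X ^ p) B0; lia.
Qed.

Lemma exec_add s i j k v :
  reg s j + reg s k = v -> exec (Add i j k) s 1 (set_reg s i v).
Proof. by move=> <-; apply: ExecAdd. Qed.

Lemma exec_sub s i j k v :
  reg s j - reg s k = v -> exec (Defs.Sub i j k) s 1 (set_reg s i v).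
Proof. by move=> <-; apply: ExecSub. Qed.

(** * Expression combinators *)

Definition econst c : nat -> cmd := fun d => Const d c.
(** There is no move instruction: a register is copied by adding it to 0. *)
Definition evar i : nat -> cmd := fun d => Seq (Const d 0) (Add d i d).
Definition eadd (a b : nat -> cmd) : nat -> cmd :=
  fun d => Seq (a d) (Seq (b d.+1) (Add d d d.+1)).
Definition esub (a b : nat -> cmd) : nat -> cmd :=
  fun d => Seq (a d) (Seq (b d.+1) (Defs.Sub d d d.+1)).
Definition eload (a : nat -> cmd) : nat -> cmd := fun d => Seq (a d) (Read d d).
Definition eif (c a b : nat -> cmd) : nat -> cmd :=
  fun d => Seq (c d) (If d (a d) (b d)).
Definition elet (a : nat -> cmd) (body : nat -> nat -> cmd) : nat -> cmd :=
  fun d => Seq (a d) (Seq (body d d.+1) (Seq (Const d 0) (Add d d d.+1))).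

(* The body gets the registers of the current value and of the index, which
   runs downwards. *)
Definition eloop (a n : nat -> cmd) (body : nat -> nat -> nat -> cmd)
    : nat -> cmd :=
  fun d => Seq (a d) (Seq (n d.+1) (While d.+1
    (Seq (Const d.+2 1) (Seq (Defs.Sub d.+1 d.+1 d.+2)
    (Seq (body d d.+1 d.+2) (Seq (Const d 0) (Add d d d.+2))))))).

Lemma ev_const X D s c : 1 < X -> evaluates X (econst c) D s c 0.
Proof.
move=> X1 d s1 led ag; exists 1, (set_reg s1 d c); split=> //.
- exact: ExecConst.
- by rewrite /= updE eqxx.
- exact/agree_set_reg/agree_refl.
Qed.

Lemma ev_var X D s i : 1 < X -> i < D -> evaluates X (evar i) D s (reg s i) 1.
Proof.
move=> X1 ltiD d s1 led ag; exists (1 + 1), (set_reg (set_reg s1 d 0) d (reg s i)).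
split=> //.
- apply: ExecSeq; first exact: ExecConst.
  by apply: exec_add; rewrite /= !updE eqxx addn0 ifN; [apply: ag.1 | lia].
- by rewrite /= updE eqxx.
- by do 2!apply: agree_set_reg => //; apply: agree_refl.
Qed.

Lemma ev_varE X D s i v : 1 < X -> i < D -> reg s i = v -> evaluates X (evar i) D s v 1.
Proof. by move=> X1 iD <-; apply: ev_var. Qed.

Lemma ev_add X D s a b va vb pa pb : 1 < X ->
  evaluates X a D s va pa -> evaluates X b D s vb pb ->
  evaluates X (eadd a b) D s (va + vb) (pa + pb + 2).
Proof.
move=> X1 ha hb d s1 led ag.
have [ta [s2 [ea la ra aa]]] := ha d s1 led ag.
have [|tb [s3 [eb lb rb ab]]] := hb d.+1 s2 (leqW led); first exact: agree_trans aa.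
exists (ta + (tb + 1)), (set_reg s3 d (reg s3 d + reg s3 d.+1)); split.
- by apply: ExecSeq ea _; apply: ExecSeq eb _; apply: ExecAdd.
- by rewrite addnA; apply: leq_powD.
- by rewrite /= updE eqxx rb ab.1 ?ra.
- by apply: agree_set_reg => //; apply: agree_trans aa ab.
Qed.

Lemma ev_sub X D s a b va vb pa pb : 1 < X ->
  evaluates X a D s va pa -> evaluates X b D s vb pb ->
  evaluates X (esub a b) D s (va - vb) (pa + pb + 2).
Proof.
move=> X1 ha hb d s1 led ag.
have [ta [s2 [ea la ra aa]]] := ha d s1 led ag.
have [|tb [s3 [eb lb rb ab]]] := hb d.+1 s2 (leqW led); first exact: agree_trans aa.
exists (ta + (tb + 1)), (set_reg s3 d (reg s3 d - reg s3 d.+1)); split.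
- by apply: ExecSeq ea _; apply: ExecSeq eb _; apply: ExecSub.
- by rewrite addnA; apply: leq_powD.
- by rewrite /= updE eqxx rb ab.1 ?ra.
- by apply: agree_set_reg => //; apply: agree_trans aa ab.
Qed.

Lemma ev_load X D s a va pa : 1 < X ->
  evaluates X a D s va pa -> evaluates X (eload a) D s (memory s va) (pa + 2).
Proof.
move=> X1 ha d s1 led ag.
have [t [s2 [ea la ra aa]]] := ha d s1 led ag.
exists (t + 1), (set_reg s2 d (memory s2 (reg s2 d))); split.
- by apply: ExecSeq ea _; apply: ExecRead.
- by apply: leq_add_pow => //; lia.
- by rewrite /= updE eqxx ra aa.2 ag.2.
- exact: agree_set_reg.
Qed.

Lemma ev_if X D s c a b vc v pc pa pb : 1 < X ->
  evaluates X c D s vc pc ->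
  (vc != 0 -> evaluates X a D s v pa) -> (vc = 0 -> evaluates X b D s v pb) ->
  evaluates X (eif c a b) D s v (pc + (pa + pb) + 2).
Proof.
move=> X1 hc ha hb d s1 led ag.
have [tc [s2 [ec lc rc ac]]] := hc d s1 led ag.
have X0 : 0 < X by lia.
have ag2 : agree D s s2 by apply: agree_trans ac.
have [vc0|vc0] := eqVneq vc 0.
- have [t [s3 [e l r ab]]] := hb vc0 d s2 led ag2.
  exists (tc + t.+1), s3; split=> //; last exact: agree_trans ab.
    by apply: ExecSeq ec _; apply: ExecIfF e; rewrite rc.
  rewrite addnS -addn1; apply: leq_powD => //.
  by apply: leq_trans l _; rewrite leq_pexp2l // leq_addl.
- have [t [s3 [e l r ab]]] := ha vc0 d s2 led ag2.
  exists (tc + t.+1), s3; split=> //; last exact: agree_trans ab.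
    by apply: ExecSeq ec _; apply: ExecIfT e; rewrite rc.
  rewrite addnS -addn1; apply: leq_powD => //.
  by apply: leq_trans l _; rewrite leq_pexp2l // leq_addr.
Qed.

(** The register of the bound value depends on where the expression is compiled, so the hypothesis
    on [body] ranges over all [d]. *)
Lemma ev_let X D s a body va v pa pb : 1 < X ->
  evaluates X a D s va pa ->
  (forall d s1, D <= d -> agree D s s1 -> reg s1 d = va ->
     evaluates X (body d) d.+1 s1 v pb) ->
  evaluates X (elet a body) D s v (pa + pb + 4).
Proof.
move=> X1 ha hb d s1 led ag.
have [ta [s2 [ea la ra aa]]] := ha d s1 led ag.
have ag2 : agree D s s2 by apply: agree_trans aa.
have [tb [s3 [eb lb rb ab]]] := hb d s2 led ag2 ra d.+1 s2 (leqnn _) (agree_refl _ _).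
exists (ta + (tb + (1 + 1))), (set_reg (set_reg s3 d 0) d (reg s3 d.+1)); split.
- apply: ExecSeq ea _; apply: ExecSeq eb _; apply: ExecSeq; first exact: ExecConst.
  by apply: exec_add; rewrite /= !updE eqxx add0n ifN //; lia.
- have -> : ta + (tb + (1 + 1)) = (ta + tb + 1) + 1 by lia.
  have -> : pa + pb + 4 = pa + pb + 2 + 2 by lia.
  by apply: leq_add_pow => //; [apply: leq_powD | lia].
- by rewrite /= updE eqxx rb.
- by do 2!apply: agree_set_reg => //; apply: agree_trans aa ab.
Qed.

(* [g i] is the value when the indices from [i] on have been processed. *)
Lemma ev_loop X D s a en body n g pa pn q pb : 1 < X ->
  evaluates X a D s (g n) pa -> evaluates X en D s n pn -> n <= X ^ q ->
  (forall i d s1, i < n -> D <= d -> agree D s s1 ->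
     reg s1 d = g i.+1 -> reg s1 d.+1 = i ->
     evaluates X (body d d.+1) d.+2 s1 (g i) pb) ->
  evaluates X (eloop a en body) D s (g 0) (pa + pn + 2 + (q + pb + 4) + 2).
Proof.
move=> X1 ha hn leq_n hb d s1 led ag.
have [ta [s2 [ea la ra aa]]] := ha d s1 led ag.
have [|tn [s3 [e_n ln rn an]]] := hn d.+1 s2 (leqW led); first exact: agree_trans aa.
have ag3 : agree d s1 s3 by apply: agree_trans aa an.
have rd3 : reg s3 d = g n by rewrite an.1 ?ra.
rewrite /eloop; set w := While _ _.
(* Besides the body, a round costs five steps: the test, two to decrement the counter and two to
   move the value. The final failing test costs one. *)
suff loop i : i <= n -> forall s0, agree d s1 s0 -> reg s0 d = g i ->
    reg s0 d.+1 = i ->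
  exists t s4, [/\ exec w s0 t s4, t <= 1 + i * (X ^ pb + 5), reg s4 d = g 0
    & agree d s1 s4].
  have [t [s4 [ew lw rw aw]]] := loop n (leqnn n) s3 ag3 rd3 rn.
  exists (ta + (tn + t)), s4; split=> //.
    by apply: ExecSeq ea _; apply: ExecSeq e_n ew.
  suff lt2 : t <= X ^ (q + pb + 4).
    have lt1 : ta + tn <= X ^ (pa + pn + 2).
      by apply: leq_trans (leq_powD X1 la ln); rewrite leq_addr.
    by apply: leq_trans (leq_powD X1 lt1 lt2); rewrite addnA leq_addr.
  apply: leq_trans lw _; rewrite !expnD.
  have X16 : 16 <= X ^ 4 by rewrite (@leq_exp2r 2 X 4).
  have A0 : 0 < X ^ q by rewrite expn_gt0; lia.
  have B0 : 0 < X ^ pb by rewrite expn_gt0; lia.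
  apply: leq_trans (leq_mul (leqnn _) X16).
  have := leq_mul leq_n (leqnn (X ^ pb + 5)).
  have := leq_pmull (X ^ pb) A0; have := leq_pmulr (X ^ q) B0; lia.
elim: i => [_|i IH lti] s0 ag0 r0 rc0.
  exists 1, s0; split=> //; exact: ExecWhileF.
set sa := set_reg s0 d.+2 1.
set sb := set_reg sa d.+1 i.
have agb : agree d s1 sb.
  by do 2!(apply: agree_set_reg; first lia).
have rb : reg sb d = g i.+1 by rewrite /= !updE !ifN ?r0 //; lia.
have rcb : reg sb d.+1 = i by rewrite /= updE eqxx.
have agD : agree D s sb by apply: agree_trans agb.
have [tb [sc [eb lb rvb ab]]] :=
  hb i d sb lti led agD rb rcb d.+2 sb (leqnn _) (agree_refl _ _).
set sd := set_reg (set_reg sc d 0) d (g i).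
have agd : agree d s1 sd.
  do 2!(apply: agree_set_reg; first lia).
  by apply: agree_trans agb (_ : agree d.+2 sb sc) => //; lia.
have [||t [s4 [ew lw rw aw]]] := IH (ltnW lti) sd agd.
- by rewrite /= updE eqxx.
- rewrite /= !updE !ifN ?ab.1 //; lia.
exists (1 + (1 + (tb + (1 + 1))) + t).+1, s4; split=> //.
- apply: ExecWhileT ew; first by rewrite rc0.
  apply: ExecSeq; first exact: ExecConst.
  rewrite -/sa; apply: ExecSeq.
    apply: (@exec_sub _ _ _ _ i).
    rewrite /= !updE eqxx ifN ?rc0 ?subn1 //; lia.
  apply: ExecSeq eb _; apply: ExecSeq; first exact: ExecConst.
  apply: (@exec_add _ _ _ _ (g i)).
  rewrite /= !updE eqxx ifN ?rvb //; lia.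
- rewrite mulSn; lia.
Qed.

(** * Arithmetic and Boolean operations *)

Definition esum (n : nat -> cmd) (body : nat -> nat -> cmd) : nat -> cmd :=
  eloop (econst 0) n (fun acc i => eadd (evar acc) (body i)).
(** Repeated addition: the time depends on the value of [b], which must therefore be polynomially
    bounded, while [a] may be large. *)
Definition emul (a b : nat -> cmd) : nat -> cmd := esum b (fun=> a).
Definition epow2 (a : nat -> cmd) : nat -> cmd :=
  eloop (econst 1) a (fun acc _ => eadd (evar acc) (evar acc)).
Definition ediv (a b : nat -> cmd) : nat -> cmd :=
  eloop (econst 0) a (fun acc _ =>
    eif (esub (emul (eadd (evar acc) (econst 1)) b) a)
      (evar acc) (eadd (evar acc) (econst 1))).
Definition emod (a b : nat -> cmd) : nat -> cmd := esub a (emul (ediv a b) b).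
Definition elt (a b : nat -> cmd) : nat -> cmd :=
  eif (esub b a) (econst 1) (econst 0).
Definition eeq (a b : nat -> cmd) : nat -> cmd :=
  eif (esub a b) (econst 0) (eif (esub b a) (econst 0) (econst 1)).
Definition eand (a b : nat -> cmd) : nat -> cmd := eif a b (econst 0).
Definition eor (a b : nat -> cmd) : nat -> cmd := eif a (econst 1) b.

Lemma ev_eq X e D s v v' p : v = v' -> evaluates X e D s v p -> evaluates X e D s v' p.
Proof. by move=> ->. Qed.

Lemma ev_sum X D s en body n f pn q pb : 1 < X ->
  evaluates X en D s n pn -> n <= X ^ q ->
  (forall i d s1, i < n -> D <= d -> agree D s s1 -> reg s1 d = i ->
     evaluates X (body d) d.+1 s1 (f i) pb) ->
  evaluates X (esum en body) D s (\sum_(i < n) f i)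
    (0 + pn + 2 + (q + (1 + pb + 2) + 4) + 2).
Proof.
move=> X1 hn leq_n hb; rewrite -(big_mkord predT f).
(* The index runs downwards, so the accumulator holds the sum over the indices from [i] on. *)
apply: (ev_loop (n := n) (g := fun i => \sum_(i <= j < n) f j)) => //.
  by rewrite big_geq //; apply: ev_const.
move=> i d s1 lti led ag rd rd1; rewrite big_ltn // addnC.
apply: ev_add => //; first exact: ev_varE.
by apply: hb => //; lia.
Qed.

Lemma ev_mul X D s a b va vb pa pb q : 1 < X ->
  evaluates X a D s va pa -> evaluates X b D s vb pb -> vb <= X ^ q ->
  evaluates X (emul a b) D s (va * vb) (0 + pb + 2 + (q + (1 + pa + 2) + 4) + 2).
Proof.
move=> X1 ha hb leq_b.
apply: ev_eq (ev_sum (f := fun=> va) X1 hb leq_b _).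
  by rewrite sum_nat_const card_ord mulnC.
by move=> i d s1 lti led ag _; apply: ev_weaken ag => //; lia.
Qed.

Lemma ev_pow2 X D s a va pa q : 1 < X ->
  evaluates X a D s va pa -> va <= X ^ q ->
  evaluates X (epow2 a) D s (2 ^ va) (0 + pa + 2 + (q + (1 + 1 + 2) + 4) + 2).
Proof.
move=> X1 ha leq_a; rewrite -[va in 2 ^ va]subn0.
apply: (ev_loop (n := va) (g := fun i => 2 ^ (va - i))) => //.
  by rewrite subnn; apply: ev_const.
move=> i d s1 lti led ag rd _; rewrite subnS in rd.
have -> : 2 ^ (va - i) = 2 ^ (va - i).-1 + 2 ^ (va - i).-1.
  by rewrite addnn -mul2n -expnS prednK // subn_gt0.
by apply: ev_add => //; apply: ev_varE => //; lia.
Qed.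

Lemma ev_lt X D s a b va vb pa pb : 1 < X ->
  evaluates X a D s va pa -> evaluates X b D s vb pb ->
  evaluates X (elt a b) D s (va < vb) (pb + pa + 2 + (0 + 0) + 2).
Proof.
move=> X1 ha hb; apply: (ev_if X1 (ev_sub X1 hb ha)) => h.
  have -> : va < vb by lia.
  exact: ev_const.
have -> : va < vb = false by lia.
  exact: ev_const.
Qed.

Lemma ev_eqn X D s a b va vb pa pb : 1 < X ->
  evaluates X a D s va pa -> evaluates X b D s vb pb ->
  evaluates X (eeq a b) D s (va == vb)
    (pa + pb + 2 + (0 + (pb + pa + 2 + (0 + 0) + 2)) + 2).
Proof.
move=> X1 ha hb; apply: (ev_if X1 (ev_sub X1 ha hb)) => h.
  have -> : va == vb = false by lia.
  exact: ev_const.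
apply: (ev_if X1 (ev_sub X1 hb ha)) => h1.
  have -> : va == vb = false by lia.
  exact: ev_const.
have -> : va == vb by lia.
  exact: ev_const.
Qed.

Lemma ev_and X D s a b (va vb : bool) pa pb : 1 < X ->
  evaluates X a D s va pa -> (va -> evaluates X b D s vb pb) ->
  evaluates X (eand a b) D s (va && vb) (pa + (pb + 0) + 2).
Proof.
move=> X1 ha hb; apply: (ev_if X1 ha).
  by case: va hb {ha} => //= hb _; apply: hb.
by case: va hb {ha} => //= _ _; apply: ev_const.
Qed.

Lemma ev_or X D s a b (va vb : bool) pa pb : 1 < X ->
  evaluates X a D s va pa -> (~~ va -> evaluates X b D s vb pb) ->
  evaluates X (eor a b) D s (va || vb) (pa + (0 + pb) + 2).
Proof.
move=> X1 ha hb; apply: (ev_if X1 ha).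
  by case: va hb {ha} => //= _ _; apply: ev_const.
by case: va hb {ha} => //= hb _; apply: hb.
Qed.

(** The accumulator grows by one per round until it reaches the quotient, so after [va - i] rounds
    it is the minimum of [va - i] and [va %/ vb]; as the quotient is at most [va], that many rounds
    suffice. *)
Lemma ev_div X D s a b va vb pa pb q q' : 1 < X ->
  evaluates X a D s va pa -> evaluates X b D s vb pb -> 0 < vb ->
  va <= X ^ q -> vb <= X ^ q' ->
  evaluates X (ediv a b) D s (va %/ vb)
    (0 + pa + 2 + (q + ((0 + pb + 2 + (q' + (1 + (1 + 0 + 2) + 2) + 4) + 2) + pa
         + 2 + (1 + (1 + 0 + 2)) + 2) + 4) + 2).
Proof.
move=> X1 ha hb vb0 leq_a leq_b.
have -> : va %/ vb = minn (va - 0) (va %/ vb).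
  by rewrite subn0; apply/esym/minn_idPr; apply: leq_div.
apply: (ev_loop (n := va) (g := fun i => minn (va - i) (va %/ vb))) => //.
  by rewrite subnn min0n; apply: ev_const.
move=> i d s1 lti led ag rd _.
set c := minn (va - i.+1) _ in rd.
have hc : evaluates X (evar d) d.+2 s1 c 1 by apply: ev_varE.
have hc1 : evaluates X (eadd (evar d) (econst 1)) d.+2 s1 (c + 1) (1 + 0 + 2).
  by apply: ev_add => //; apply: ev_const.
have hb1 : evaluates X b d.+2 s1 vb pb by apply: ev_weaken ag => //; lia.
have ha1 : evaluates X a d.+2 s1 va pa by apply: ev_weaken ag => //; lia.
have cE : ((c + 1) * vb <= va) = (c + 1 <= va %/ vb) by rewrite leq_divRL.
apply: (ev_if X1 (ev_sub X1 (ev_mul X1 hc1 hb1 leq_b) ha1)).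
- move=> h; have <- : c = minn (va - i) (va %/ vb); last by [].
  move: h; rewrite subn_eq0 cE /c; move: (va %/ vb) => k; clear -lti; lia.
- move=> /eqP h; have <- : c + 1 = minn (va - i) (va %/ vb); last by [].
  move: h; rewrite subn_eq0 cE /c; move: (va %/ vb) => k; clear -lti; lia.
Qed.

Lemma ev_mod X D s a b va vb pa pb q q' : 1 < X ->
  evaluates X a D s va pa -> evaluates X b D s vb pb -> 0 < vb ->
  va <= X ^ q -> vb <= X ^ q' ->
  evaluates X (emod a b) D s (va %% vb)
    (pa + (0 + pb + 2 + (q' + (1 + (0 + pa + 2 + (q + ((0 + pb + 2
       + (q' + (1 + (1 + 0 + 2) + 2) + 4) + 2) + pa + 2 + (1 + (1 + 0 + 2)) + 2)
       + 4) + 2) + 2) + 4) + 2) + 2).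
Proof.
move=> X1 ha hb vb0 leq_a leq_b.
have -> : va %% vb = va - va %/ vb * vb by rewrite {2}(divn_eq va vb) addKn.
exact: (ev_sub X1 ha (ev_mul X1 (ev_div X1 ha hb vb0 leq_a leq_b) hb leq_b)).
Qed.

(** * Sequences of commands and filling of memory blocks *)

Definition runs X c s s' p := exists2 t, exec c s t s' & t <= X ^ p.

Lemma runs_seq X c1 c2 s s1 s2 p1 p2 : 1 < X ->
  runs X c1 s s1 p1 -> runs X c2 s1 s2 p2 -> runs X (Seq c1 c2) s s2 (p1 + p2 + 2).
Proof.
move=> X1 [t1 e1 l1] [t2 e2 l2]; exists (t1 + t2); first exact: ExecSeq e1 e2.
by have := leq_powD X1 l1 l2; lia.
Qed.

Lemma runs_assign X e D s v p : evaluates X e D s v p ->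
  exists s1, [/\ runs X (e D) s s1 p, reg s1 D = v & agree D s s1].
Proof.
move=> /(_ D s (leqnn D) (agree_refl D s))[t [s1 [ex le rv ag]]].
by exists s1; split=> //; exists t.
Qed.

Definition fill (base n : nat -> cmd) (body : nat -> nat -> cmd) : nat -> cmd :=
  fun d => Seq (n d) (While d
    (Seq (Const d.+1 1) (Seq (Defs.Sub d d d.+1)
    (Seq (eadd base (evar d) d.+1) (Seq (body d d.+2) (Write d.+1 d.+2)))))).

(** When [body] runs, part of the block may already be overwritten, so its correctness may rely only
    on the cells outside the block. The base address must not depend on the memory at all. *)
Lemma runs_fill X D s en base body n b w pn q p0 pb : 1 < X ->
  evaluates X en D s n pn -> n <= X ^ q ->
  (forall s1, (forall j, j < D -> reg s1 j = reg s j) -> evaluates X base D s1 b p0) ->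
  (forall i s1, i < n -> (forall j, j < D -> reg s1 j = reg s j) ->
     (forall a, ~~ (b <= a < b + n) -> memory s1 a = memory s a) ->
     reg s1 D = i -> evaluates X (body D) D.+1 s1 (w i) pb) ->
  exists s', [/\ runs X (fill base en body D) s s'
      (pn + (q + (p0 + 1 + 2 + pb + 2) + 4) + 2),
    forall j, j < D -> reg s' j = reg s j
  & memory s' = fun a => if b <= a < b + n then w (a - b) else memory s a].
Proof.
move=> X1 hn leq_n hbase hb.
have [tn [s1 [e_n ln rn an]]] := hn D s (leqnn D) (agree_refl _ _).
set p := p0 + 1 + 2 + pb + 2.
rewrite /fill; set wh := While _ _.
suff loop i : i <= n -> forall s0, (forall j, j < D -> reg s0 j = reg s j) ->
    reg s0 D = i ->
    (forall a, memory s0 a = if b + i <= a < b + n then w (a - b) else memory s a) ->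
  exists t s4, [/\ exec wh s0 t s4, t <= 1 + i * (X ^ p + 4),
    forall j, j < D -> reg s4 j = reg s j
    & memory s4 = fun a => if b <= a < b + n then w (a - b) else memory s a].
  have [|t [s4 [ew lw rw mw]]] := loop n (leqnn n) s1 an.1 rn.
    by move=> a; rewrite ifN ?an.2 //; lia.
  exists s4; split=> //; exists (tn + t); first exact: ExecSeq ew.
  suff lt2 : t <= X ^ (q + p + 4).
    by apply: leq_trans (leq_powD X1 ln lt2); rewrite leq_addr.
  apply: leq_trans lw _; rewrite (expnD _ (q + p)) expnD.
  have X16 : 16 <= X ^ 4 by rewrite (@leq_exp2r 2 X 4).
  have A0 : 0 < X ^ q by rewrite expn_gt0; lia.
  have B0 : 0 < X ^ p by rewrite expn_gt0; lia.
  apply: leq_trans (leq_mul (leqnn _) X16).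
  have := leq_mul leq_n (leqnn (X ^ p + 4)).
  have := leq_pmull (X ^ p) A0; have := leq_pmulr (X ^ q) B0; lia.
elim: i => [_|i IH lti] s0 rg0 rc0 m0.
  exists 1, s0; split=> //; first exact: ExecWhileF.
  by apply/funext => a; rewrite m0 addn0.
set sa := set_reg s0 D.+1 1.
set sb := set_reg sa D i.
have rgb j : j < D -> reg sb j = reg s j.
  by move=> ltj; rewrite /= !updE !ifN ?rg0 //; lia.
have rcb : reg sb D = i by rewrite /= updE eqxx.
have ha : evaluates X (eadd base (evar D)) D.+1 sb (b + i) (p0 + 1 + 2).
  apply: ev_add => //; last exact: ev_varE.
  apply: ev_weaken (hbase sb rgb) _ _ => //; exact: agree_refl.
have [t1 [s2 [e1 l1 r1 a1]]] := ha D.+1 sb (leqnn _) (agree_refl _ _).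
have rg2 j : j < D -> reg s2 j = reg s j by move=> ltj; rewrite a1.1 ?rgb //; lia.
have m2 a : ~~ (b <= a < b + n) -> memory s2 a = memory s a.
  by move=> h; rewrite a1.2 /= m0 ifN //; lia.
have rc2 : reg s2 D = i by rewrite a1.1.
have [t2 [s3 [e2 l2 r2 a2]]] :=
  hb i s2 lti rg2 m2 rc2 D.+2 s2 (leqnSn _) (agree_refl _ _).
have r13 : reg s3 D.+1 = b + i by rewrite a2.1.
set s4 := Defs.set_mem s3 (b + i) (w i).
have rg4 j : j < D -> reg s4 j = reg s j by move=> ltj; rewrite a2.1 ?rg2 //; lia.
have rc4 : reg s4 D = i by rewrite /= a2.1 ?rc2 //; lia.
have m4 a : memory s4 a = if b + i <= a < b + n then w (a - b) else memory s a.
  rewrite /= updE; case: eqP => [->|ne].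
    by rewrite ifT ?addKn //; lia.
  rewrite a2.2 a1.2 /= m0; congr (if _ then _ else _); lia.
have [t [s5 [ew lw rw mw]]] := IH (ltnW lti) s4 rg4 rc4 m4.
exists (1 + (1 + (t1 + (t2 + 1))) + t).+1, s5; split=> //.
- apply: ExecWhileT ew; first by rewrite rc0.
  apply: ExecSeq; first exact: ExecConst.
  apply: ExecSeq.
    apply: (@exec_sub _ _ _ _ i).
    rewrite /= !updE eqxx ifN ?rc0 ?subn1 //; lia.
  apply: ExecSeq e1 _; apply: ExecSeq e2 _.
  by rewrite /s4 -r13 -r2; apply: ExecWrite.
- have := leq_powD X1 l1 l2; rewrite -/p mulSn; lia.
Qed.

(** * Clearing the scratch registers *)

Fixpoint clear_regs (n : nat) : cmd :=
  if n is n'.+1 then Seq (Const n 0) (clear_regs n') else Skip.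

Lemma exec_clear_regs n s : exec (clear_regs n) s n.+1
  (State (fun j => if 0 < j <= n then 0 else reg s j) (memory s)).
Proof.
elim: n s => [|n IH] s /=.
  have <- : s = State (fun j => if 0 < j <= 0 then 0 else reg s j) (memory s).
    case: s => r m; congr State; apply/funext => j /=; rewrite ifN //; lia.
  exact: ExecSkip.
apply: (@ExecSeq _ _ _ _ _ 1 n.+1); first exact: ExecConst.
have <- : State (fun j => if 0 < j <= n then 0 else reg (set_reg s n.+1 0) j) (memory s)
   = State (fun j => if 0 < j <= n.+1 then 0 else reg s j) (memory s).
  congr State; apply/funext => j /=; rewrite updE.
  by case: eqP => [->|ne]; [rewrite ltnn andbF ltnSn | congr (if _ then _ else _); lia].
exact: IH.
Qed.

Fixpoint reg_bound (c : cmd) : nat :=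
  match c with
  | Skip | Write _ _ => 0
  | Const i _ | Add i _ _ | Defs.Sub i _ _ | Read i _ => i.+1
  | Seq c1 c2 | If _ c1 c2 => maxn (reg_bound c1) (reg_bound c2)
  | While _ c1 => reg_bound c1
  end.

Lemma exec_reg_bound c s t s' : exec c s t s' ->
  forall j, reg_bound c <= j -> reg s' j = reg s j.
Proof.
elim=> //=.
- by move=> s0 i k j h; rewrite updE ifN //; lia.
- by move=> s0 i k l j h; rewrite updE ifN //; lia.
- by move=> s0 i k l j h; rewrite updE ifN //; lia.
- by move=> s0 i k j h; rewrite updE ifN //; lia.
- move=> c1 c2 s0 s1 s2 t1 t2 _ h1 _ h2 j; rewrite geq_max => /andP[l1 l2].
  by rewrite h2 ?h1.
- move=> i c1 c2 s0 s1 t1 _ _ h1 j; rewrite geq_max => /andP[l1 l2].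
  by rewrite h1.
- move=> i c1 c2 s0 s1 t1 _ _ h1 j; rewrite geq_max => /andP[l1 l2].
  by rewrite h1.
- by move=> i c1 s0 s1 s2 t1 t2 _ _ h1 _ h2 j hj; rewrite h2 ?h1.
Qed.

(** * From a selection problem to offensive alliances *)

Lemma sum_nat_shift (F : nat -> nat) a n :
  \sum_(a <= u < a + n) F u = \sum_(0 <= e < n) F (a + e).
Proof.
by rewrite -{1}[a]add0n big_addn addKn; apply: eq_bigr => e _; rewrite addnC.
Qed.

Lemma sum_nat_divmod (F : nat -> nat) n k :
  \sum_(0 <= e < n * k) F e = \sum_(0 <= i < n) \sum_(0 <= j < k) F (i * k + j).
Proof.
rewrite big_nat_mul; apply: eq_bigr => i _.
by rewrite mulSn addnC sum_nat_shift.
Qed.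

Lemma sum_nat_ge1 (P : nat -> bool) n j : j < n -> P j -> 1 <= \sum_(0 <= i < n) P i.
Proof.
by move=> ltjn Pj; rewrite big_mkord (bigD1 (Ordinal ltjn)) //= Pj.
Qed.

Lemma sum_nat_exists (P : nat -> bool) n :
  1 <= \sum_(0 <= i < n) P i -> exists2 j, j < n & P j.
Proof.
elim: n => [|n IH]; first by rewrite big_geq.
rewrite big_nat_recr //=; case Pn : (P n); first by exists n.
by rewrite addn0 => /IH[j ltj Pj]; exists j => //; lia.
Qed.

Lemma sum_nat_le1 (P : nat -> bool) n i j :
  \sum_(0 <= i < n) P i <= 1 -> i < n -> j < n -> P i -> P j -> i = j.
Proof.
move=> le1 lti ltj Pi Pj; apply/eqP/negPn/negP => ne.
move: le1; rewrite big_mkord (bigD1 (Ordinal lti)) //= (bigD1 (Ordinal ltj)) /=.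
  by rewrite Pi Pj.
by rewrite eq_sym.
Qed.

Lemma sum_nat_all (P : nat -> bool) n :
  (forall i, i < n -> P i) -> \sum_(0 <= i < n) P i = n.
Proof.
move=> allP; rewrite (@eq_big_nat _ _ _ 0 n _ (fun=> 1)); last first.
  by move=> i /andP[_ /allP->].
by rewrite sum_nat_const_nat subn0 muln1.
Qed.

Lemma sum_nat_ltn (n q : nat) : \sum_(0 <= u < n) (u < q) = minn n q.
Proof.
elim: n => [|n IH]; first by rewrite big_geq // min0n.
rewrite big_nat_recr //= IH; case: ltnP; lia.
Qed.

(* Vertices: a clique of size 8k+2, whose vertices have too large a degree to be
   attacked by 4k vertices; 3k vertices forced into every alliance; the k*k
   elements that can be selected; and the constraints. *)
Definition off_forced k := 8 * k + 2.
Definition off_elem k := off_forced k + 3 * k.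
Definition off_constr k := off_elem k + k * k.
Definition order k m := off_constr k + (k + m).

(* The number of clique neighbours is chosen so that a constraint has degree
   6k+1, hence is satisfied exactly by the forced vertices and one element. *)
Definition pad k (hits : nat -> nat -> bool) c :=
  3 * k + 1 - \sum_(0 <= e < k * k) hits c e.

(** Each edge is described from one endpoint [v]: the larger one inside the clique, the constraint
    otherwise. Symmetrising gives [adj]. *)
Definition half_adj k (hits : nat -> nat -> bool) u v : bool :=
  if v < off_forced k then u < v
  else if v < off_constr k then false
  else if u < off_forced k then u < pad k hits (v - off_constr k)
  else if u < off_elem k then true
  else if u < off_constr k then hits (v - off_constr k) (u - off_elem k)
  else false.

Definition adj k hits u v := half_adj k hits u v || half_adj k hits v u.

Lemma adj_sym k hits : symmetric (adj k hits).
Proof. by move=> u v; rewrite /adj orbC. Qed.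

Lemma adj_irr k hits : irreflexive (adj k hits).
Proof.
move=> u; rewrite /adj orbb /half_adj ltnn.
case: ifP => // h1; case: ifP => // h2; rewrite ?h1 ?h2.
by rewrite ifF //; move: h2; rewrite /off_constr; lia.
Qed.

Lemma sum_vertices (F : nat -> nat) k m :
  \sum_(0 <= u < order k m) F u =
    \sum_(0 <= u < off_forced k) F u + \sum_(0 <= e < 3 * k) F (off_forced k + e)
    + \sum_(0 <= e < k * k) F (off_elem k + e)
    + \sum_(0 <= e < k + m) F (off_constr k + e).
Proof.
rewrite (big_cat_nat (n := off_constr k)) ?leq_addr //= (sum_nat_shift F (off_constr k)); congr addn.
rewrite (big_cat_nat (n := off_elem k)) ?leq_addr //= (sum_nat_shift F (off_elem k)); congr addn.
by rewrite (big_cat_nat (n := off_forced k)) ?leq_addr //= (sum_nat_shift F (off_forced k)).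
Qed.

Lemma adj_constrK k hits c u : u < off_forced k ->
  adj k hits (off_constr k + c) u = (u < pad k hits c).
Proof.
move=> h; have ltC : off_forced k <= off_constr k by rewrite /off_constr /off_elem; lia.
rewrite /adj /half_adj h addKn.
rewrite ifF ?(ltnNge _ (off_constr k)) ?leq_addr //=; last by lia.
by rewrite (_ : _ + _ < u = false) //; lia.
Qed.

Lemma adj_constr_forced k hits c e : e < 3 * k ->
  adj k hits (off_constr k + c) (off_forced k + e).
Proof.
move=> h; rewrite /adj /half_adj addKn.
rewrite (_ : off_forced k + e < off_forced k = false); last by lia.
rewrite (_ : off_forced k + e < off_constr k); last by rewrite /off_constr /off_elem; lia.
rewrite (_ : off_constr k + c < off_constr k = false); last by lia.
rewrite (_ : off_constr k + c < off_forced k = false); last by rewrite /off_constr /off_elem; lia.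
by rewrite (_ : off_forced k + e < off_elem k) // /off_elem; lia.
Qed.

Lemma adj_constr_elem k hits c e : e < k * k ->
  adj k hits (off_constr k + c) (off_elem k + e) = hits c e.
Proof.
move=> h; rewrite /adj /half_adj !addKn.
rewrite (_ : off_elem k + e < off_forced k = false); last by rewrite /off_elem; lia.
rewrite (_ : off_elem k + e < off_constr k); last by rewrite /off_constr; lia.
rewrite (_ : off_constr k + c < off_constr k = false); last by lia.
rewrite (_ : off_constr k + c < off_forced k = false); last by rewrite /off_constr /off_elem; lia.
by rewrite (_ : off_elem k + e < off_elem k = false) //; lia.
Qed.

Lemma adj_constr_constr k hits c d :
  adj k hits (off_constr k + c) (off_constr k + d) = false.
Proof.
rewrite /adj /half_adj.
do 2!(rewrite (_ : off_constr k + _ < off_forced k = false);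
  last by rewrite /off_constr /off_elem; lia).
do 2!(rewrite (_ : off_constr k + _ < off_elem k = false);
  last by rewrite /off_constr; lia).
by do 2!(rewrite (_ : off_constr k + _ < off_constr k = false); last by lia).
Qed.

Lemma adj_clique k hits u v : u < off_forced k -> v < off_forced k ->
  adj k hits u v = (u != v).
Proof. by move=> hu hv; rewrite /adj /half_adj hu hv -neq_ltn. Qed.

(** Clique neighbours and hit elements add up to 3k+1 by the choice of [pad], whose subtraction does
    not truncate under the hypothesis. The forced vertices add 3k, and constraints are pairwise
    non-adjacent. *)
Lemma degree_constr k (hits : nat -> nat -> bool) m c :
  \sum_(0 <= e < k * k) hits c e <= 3 * k ->
  \sum_(0 <= u < order k m) adj k hits (off_constr k + c) u = 6 * k + 1.
Proof.
move=> le3k; rewrite sum_vertices.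
under eq_big_nat => u /andP[_ h] do rewrite adj_constrK //.
rewrite sum_nat_ltn sum_nat_all; last by move=> e; apply: adj_constr_forced.
under [X in _ + X + _]eq_big_nat => u /andP[_ h] do rewrite adj_constr_elem //.
under [X in _ + X]eq_big_nat => u /andP[_ h] do rewrite adj_constr_constr.
rewrite [X in _ + X]big1 // /pad /off_forced; lia.
Qed.

Lemma sdegree_constr k (hits : nat -> nat -> bool) m c (s : nat -> bool) :
  (forall u, u < off_forced k -> ~~ s u) ->
  \sum_(0 <= u < order k m) (s u && adj k hits (off_constr k + c) u) =
  \sum_(0 <= e < 3 * k) s (off_forced k + e)
  + \sum_(0 <= e < k * k) (s (off_elem k + e) && hits c e).
Proof.
move=> sK; rewrite sum_vertices.
under eq_big_nat => u /andP[_ h] do rewrite (negbTE (sK u h)) /=.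
rewrite big1 // add0n.
under eq_big_nat => u /andP[_ h] do rewrite adj_constr_forced // andbT.
under [X in _ + X + _]eq_big_nat => u /andP[_ h] do rewrite adj_constr_elem //.
under [X in _ + X]eq_big_nat => u /andP[_ h] do rewrite adj_constr_constr andbF.
by rewrite [X in _ + X]big1 // addn0.
Qed.

(** The neighbours inside the clique alone are that many. *)
Lemma degree_clique k hits m u : u < off_forced k ->
  8 * k + 1 <= \sum_(0 <= v < order k m) adj k hits u v.
Proof.
move=> h; rewrite sum_vertices -!addnA; apply: leq_trans (leq_addr _ _).
under eq_big_nat => v /andP[_ h'] do rewrite adj_clique //.
have : \sum_(0 <= v < off_forced k) ((u != v) + (v == u)) = off_forced k.
  rewrite -[RHS](@sum_nat_all predT) //; apply: eq_bigr => v _.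
  by rewrite eq_sym; case: eqP.
rewrite big_split /= => hs.
have : \sum_(0 <= v < off_forced k) (v == u) <= 1; last first.
  by move: hs; rewrite /off_forced; lia.
by rewrite big_mkord (bigD1 (Ordinal h)) //= eqxx big1 // => i; rewrite -val_eqE /= => /negbTE->.
Qed.

(** * The graph and its degrees *)

Definition adj_graph k hits m : sgraph 'I_(order k m) :=
  @SGraph _ (fun u v : 'I_(order k m) => adj k hits u v)
    (fun u v => adj_sym k hits u v) (fun u => adj_irr k hits u).

(** Membership is extended to all naturals so that degrees and cardinalities become sums over
    intervals, which split along the vertex ranges. *)
Definition nat_set n (S : {set 'I_n}) (u : nat) : bool :=
  if insub u is Some i then i \in S else false.

Lemma nat_setE n (S : {set 'I_n}) (i : 'I_n) : nat_set S i = (i \in S).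
Proof. by rewrite /nat_set valK. Qed.

Lemma card_nat_set n (S : {set 'I_n}) : #|S| = \sum_(0 <= u < n) nat_set S u.
Proof.
rewrite big_mkord -sum1_card big_mkcond /=; apply: eq_bigr => i _.
by rewrite nat_setE; case: (i \in S).
Qed.

Lemma degree_in_nat_set k hits m (S : {set 'I_(order k m)}) v :
  degree_in (adj_graph k hits m) S v
    = \sum_(0 <= u < order k m) (nat_set S u && adj k hits v u).
Proof.
rewrite /degree_in -sum1dep_card big_mkord big_mkcond /=; apply: eq_bigr => i _.
by rewrite nat_setE; case: (_ && _).
Qed.

(** Turns the alliance inequality at [v] into the condition that more than half of the degree of [v]
    lies in [S]. *)
Lemma degree_inC k hits m (S : {set 'I_(order k m)}) v :
  degree_in (adj_graph k hits m) S v + degree_in (adj_graph k hits m) (~: S) v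
    = \sum_(0 <= u < order k m) adj k hits v u.
Proof.
rewrite !degree_in_nat_set -big_split /= !big_mkord; apply: eq_bigr => i _.
by rewrite !nat_setE inE; case: (i \in S); rewrite /= ?addn0.
Qed.

(** Element [i * k + a i] is the choice in group [i]. Only the clause constraints appear: a choice
    in every group already meets the group constraints. *)
Definition selectable k (hits : nat -> nat -> bool) m : Prop :=
  exists2 a : nat -> nat, forall i, i < k -> a i < k &
  forall c, k <= c < k + m -> exists2 i, i < k & hits c (i * k + a i).

(** The alliance consists of the 3k forced vertices and the k chosen elements. Its neighbours are
    all constraints, of degree 6k+1, so each needs 3k+1 neighbours inside. *)
Lemma selection_alliance k hits m : 1 < k ->
  (forall c e, c < k -> hits c e = (e %/ k == c)) ->
  (forall c, c < k + m -> \sum_(0 <= e < k * k) hits c e <= 3 * k) ->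
  selectable k hits m ->
  exists S : {set 'I_(order k m)},
    offensive_alliance (adj_graph k hits m) S /\ 1 <= #|S| <= 4 * k.
Proof.
move=> k1 hits_group hits_le [a lt_a ha].
pose s (u : nat) := (off_forced k <= u < off_constr k) &&
  ((u < off_elem k) || ((u - off_elem k) %% k == a ((u - off_elem k) %/ k))).
pose S := [set u : 'I_(order k m) | s u].
have sE u : u < order k m -> nat_set S u = s u.
  by move=> h; rewrite (nat_setE S (Ordinal h)) inE.
have sK u : u < off_forced k -> ~~ s u by rewrite /s; lia.
have sF e : e < 3 * k -> s (off_forced k + e).
  by rewrite /s /off_constr /off_elem; lia.
have sU e : e < k * k -> s (off_elem k + e) = (e %% k == a (e %/ k)).
  move=> h; rewrite /s addKn (_ : _ < off_elem k = false); last by lia.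
  by rewrite (_ : _ <= _ < _) // /off_constr /off_elem; lia.
have cardS : #|S| = 4 * k.
  rewrite card_nat_set; under eq_big_nat => u /andP[_ h] do rewrite sE //.
  rewrite sum_vertices.
  rewrite big1_seq; last by move=> u; rewrite mem_index_iota => /= /sK/negbTE->.
  rewrite sum_nat_all //.
  under [X in _ + X + _]eq_big_nat => u /andP[_ h] do rewrite sU //.
  rewrite [X in _ + X]big1; last by move=> e _; rewrite /s; case: leqP; lia.
  rewrite sum_nat_divmod.
  have -> : \sum_(0 <= i < k) \sum_(0 <= j < k)
      ((i * k + j) %% k == a ((i * k + j) %/ k)) = \sum_(0 <= i < k) 1.
    apply: eq_big_nat => i /andP[_ lti]; rewrite big_mkord.
    rewrite (bigD1 (Ordinal (lt_a i lti))) //= divnMDl ?modnMDl; last by lia.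
    rewrite divn_small ?modn_small ?addn0 ?eqxx ?lt_a //.
    rewrite big1 // => j nej; rewrite divnMDl ?modnMDl; last by lia.
    rewrite divn_small ?modn_small // addn0; case: eqP => // ej.
    by case/eqP: nej; apply: val_inj.
  rewrite sum_nat_const_nat; lia.
exists S; rewrite cardS; split; last by lia.
split; first by rewrite -card_gt0 cardS; lia.
move=> v; rewrite inE => /andP[vS /existsP[u /andP[uS /= uv]]].
(* Forced vertices and elements are adjacent to constraints only, so the first case is
   impossible. *)
have [vC|vC] := ltnP v (off_constr k).
  move: uS uv; rewrite inE /s => /andP[/andP[u1 u2] _].
  rewrite /adj /half_adj vC.
  rewrite (_ : u < off_forced k = false) ?u2; last by lia.
  by rewrite orbF; case: ifP => //; lia.
set c := v - off_constr k.
have vE : v = off_constr k + c :> nat by rewrite /c subnKC.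
have ltc : c < k + m by have := ltn_ord v; rewrite {2}/order vE; lia.
have := degree_inC hits S v.
rewrite vE degree_constr ?hits_le // => dC.
suff : 3 * k + 1 <= degree_in (adj_graph k hits m) S v by lia.
rewrite degree_in_nat_set vE.
under eq_big_nat => w /andP[_ h] do rewrite sE //.
rewrite sdegree_constr // sum_nat_all // leq_add2l.
have [e lte /andP[h1 h2]] :
    exists2 e, e < k * k & (e %% k == a (e %/ k)) && hits c e; last first.
  by apply: (@sum_nat_ge1 _ _ e); rewrite // sU ?h1.
(* A group constraint is hit by the choice in its own group; a clause constraint by the hypothesis
   on the selection. *)
have [i lti hi] : exists2 i, i < k & hits c (i * k + a i).
  have [ltck|leck] := ltnP c k; last by apply: ha; rewrite leck.
  exists c => //; rewrite hits_group // divnMDl; last by lia.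
  by rewrite divn_small ?addn0 ?lt_a.
exists (i * k + a i).
  have := lt_a i lti; have := leq_mul lti (leqnn k); rewrite mulSn; lia.
rewrite hi andbT divnMDl ?modnMDl; last by lia.
by rewrite divn_small ?modn_small ?addn0 ?lt_a.
Qed.

Lemma alliance_selection k hits m : 1 < k ->
  (forall c e, c < k -> hits c e = (e %/ k == c)) ->
  (forall c, c < k + m -> \sum_(0 <= e < k * k) hits c e <= 3 * k) ->
  (exists S : {set 'I_(order k m)},
    offensive_alliance (adj_graph k hits m) S /\ 1 <= #|S| <= 4 * k) ->
  selectable k hits m.
Proof.
move=> k1 hits_group hits_le [S [[S0 Sall] /andP[_ leS]]].
pose s := nat_set S.
have lt_s u : s u -> u < order k m.
  by rewrite /s /nat_set; case: insubP => // i _ <- _; apply: ltn_ord.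
have attack u v : s u -> v < order k m -> adj k hits u v -> ~~ s v ->
    \sum_(0 <= w < order k m) adj k hits v w
      < 2 * \sum_(0 <= w < order k m) (s w && adj k hits v w).
  move=> su lt_v uv sv.
  pose v' := Ordinal lt_v; pose u' := Ordinal (lt_s u su).
  have /Sall : v' \in open_nbhd (adj_graph k hits m) S.
    rewrite inE -nat_setE sv; apply/existsP; exists u'.
    by rewrite -nat_setE; apply/andP.
  rewrite -[v]/(val v') -(degree_inC hits S) /s -degree_in_nat_set; lia.
have card_s : \sum_(0 <= w < order k m) s w <= 4 * k by rewrite -card_nat_set.
have lt_clique u : u < off_forced k -> u < order k m.
  by rewrite /order /off_constr /off_elem; lia.
(* A clique vertex outside [S] has degree at least 8k+1; if attacked, it would need more than 4k
   neighbours in [S]. *)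
have no_attack u v : s u -> v < off_forced k -> adj k hits u v -> s v.
  move=> su ltv uv; apply/negPn/negP => sv.
  have := attack u v su (lt_clique v ltv) uv sv.
  have := degree_clique hits m ltv.
  have : \sum_(0 <= w < order k m) (s w && adj k hits v w)
      <= \sum_(0 <= w < order k m) s w.
    by apply: leq_sum => w _; case: (s w) => //; case: adj.
  lia.
(* One clique vertex in [S] would draw in the whole clique, which is larger than 4k. *)
have sK u : u < off_forced k -> ~~ s u.
  move=> ltu; apply/negP => su.
  have sall v : v < off_forced k -> s v.
    move=> ltv; have [<- //|ne] := eqVneq u v.
    by apply: (no_attack u) => //; rewrite adj_clique.
  move: card_s; rewrite sum_vertices sum_nat_all // /off_forced; lia.
(* Since [pad] is at least 1, every constraint is adjacent to clique vertex 0. *)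
have sC c : c < k + m -> ~~ s (off_constr k + c).
  move=> ltc; apply/negP => sc.
  have lt0 : 0 < off_forced k by rewrite /off_forced; lia.
  have /negP := sK 0 lt0; apply; apply: (no_attack _ _ sc) => //.
  by rewrite adj_constrK // /pad; have := hits_le c ltc; lia.
pose x := \sum_(0 <= e < 3 * k) s (off_forced k + e).
pose y c := \sum_(0 <= e < k * k) (s (off_elem k + e) && hits c e).
have constr u c : c < k + m -> s u -> adj k hits (off_constr k + c) u ->
    3 * k + 1 <= x + y c.
  move=> ltc su uc.
  have ltv : off_constr k + c < order k m by rewrite /order ltn_add2l.
  have := attack u _ su ltv; rewrite adj_sym => /(_ uc (sC c ltc)).
  rewrite degree_constr ?hits_le // sdegree_constr // -/x -/(y c); lia.
(* A member of [S] is a forced vertex, adjacent to constraint 0, or an element, adjacent to the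
   constraint of its group. *)
have [c0 lt_c0 hc0] : exists2 c0, c0 < k & 3 * k + 1 <= x + y c0.
  have /set0Pn[u] := S0; rewrite -nat_setE -/s => su.
  have ltu := ltn_ord u.
  have [u1|u1] := ltnP u (off_forced k); first by have := sK _ u1; rewrite su.
  have [u2|u2] := ltnP u (off_elem k).
    have k0 : 0 < k by lia.
    exists 0 => //; apply: (constr u) => //; first by lia.
    rewrite -(subnKC u1) adj_constr_forced //.
    by move: u2; rewrite /off_elem; lia.
  have [u3|u3] := ltnP u (off_constr k).
    have lte : u - off_elem k < k * k by move: u3; rewrite {1}/off_constr; lia.
    have ltc : (u - off_elem k) %/ k < k by rewrite ltn_divLR //; lia.
    exists ((u - off_elem k) %/ k) => //; apply: (constr u) => //; first by lia.
    by rewrite -{2}(subnKC u2) adj_constr_elem // hits_group ?eqxx.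
  have ltc : u - off_constr k < k + m by move: ltu; rewrite {2}/order; lia.
  by have := sC _ ltc; rewrite subnKC // su.
have leyc c : c < k + m -> y c <= 3 * k.
  move=> ltc; apply: leq_trans (hits_le c ltc).
  by apply: leq_sum => e _; case: (s _) => //; case: hits.
(* Elements contribute at most 3k to the inequality at [c0], so some forced vertex lies in [S];
   being adjacent to every constraint, it makes all the inequalities available. *)
have [e0 lt_e0 se0] : exists2 e, e < 3 * k & s (off_forced k + e).
  apply: sum_nat_exists; rewrite -/x.
  by have := leyc c0 (ltn_addr m lt_c0); lia.
have hall c : c < k + m -> 3 * k + 1 <= x + y c.
  by move=> ltc; apply: (constr (off_forced k + e0)) => //; apply: adj_constr_forced.
pose z := \sum_(0 <= e < k * k) s (off_elem k + e).
(* Double counting: each element is hit by exactly one group constraint. *)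
have zE : \sum_(0 <= c < k) y c = z.
  rewrite exchange_big_nat /=; apply: eq_big_nat => e /andP[_ lte].
  have ltd : e %/ k < k by rewrite ltn_divLR //; lia.
  rewrite big_mkord (bigD1 (Ordinal ltd)) //= hits_group // eqxx andbT.
  rewrite big1 ?addn0 // => c nec; rewrite hits_group //.
  by rewrite eq_sym (_ : (c == _ :> nat) = false) ?andbF //; apply: negbTE.
have xz : x + z <= 4 * k.
  apply: leq_trans card_s; rewrite sum_vertices -/x -/z; lia.
have xle : x <= 3 * k.
  by apply: leq_trans (_ : \sum_(0 <= e < 3 * k) 1 <= _);
    [apply: leq_sum => e _; case: (s _) | rewrite sum_nat_const_nat; lia].
(* Summing over the groups, k(3k+1) <= kx + z <= (k-1)x + 4k, so (k-1)x >= 3k(k-1), and k > 1 gives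
   x >= 3k. *)
have xE : x = 3 * k.
  have : k * (3 * k + 1) <= k * x + z.
    rewrite -zE -{1 3}[k]subn0 -!sum_nat_const_nat -big_split /=.
    rewrite !big_mkord; apply: leq_sum => c _; apply: hall.
    by have := ltn_ord c; lia.
  nia.
(* Now z <= k, while each of the k groups contributes at least 1. *)
have y1 c : c < k -> y c <= 1.
  move=> ltc.
  have : \sum_(0 <= i < k) y i <= k by rewrite zE; lia.
  rewrite big_mkord (bigD1 (Ordinal ltc)) //=.
  have : \sum_(i < k | i != Ordinal ltc) 1 <= \sum_(i < k | i != Ordinal ltc) y i.
    by apply: leq_sum => i _; have := hall i (ltn_addr m (ltn_ord i)); lia.
  rewrite sum1_card cardC1 card_ord; set Y := \sum_(i < k | _) _.
  by move: (y c) Y => yc Y; clear -k1; lia.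
have ex c : c < k + m -> exists e, [/\ e < k * k, s (off_elem k + e) & hits c e].
  move=> ltc; have [|e lte /andP[h1 h2]] := @sum_nat_exists
    (fun e => s (off_elem k + e) && hits c e) (k * k); last by exists e.
  by have := hall c ltc; rewrite xE -/(y c); lia.
(* The implication allows a default value outside the range, so that [choice] applies. *)
have ex_a c : exists e, c < k -> [/\ e < k * k, s (off_elem k + e) & e %/ k = c].
  have [ltc|] := ltnP c k; last by exists 0.
  have [e [h1 h2 h3]] := ex c (ltn_addr m ltc); exists e => _; split=> //.
  by apply/eqP; rewrite -hits_group.
have [b hb] := choice ex_a.
have k0 : 0 < k by lia.
exists (fun c => b c %% k); first by move=> i _; rewrite ltn_mod.
move=> c /andP[_ ltc]; have [e [h1 h2 h3]] := ex c ltc.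
have lti : e %/ k < k by rewrite ltn_divLR.
exists (e %/ k) => //; have [h4 h5 h6] := hb _ lti.
(* Both [e] and the element chosen by [b] are selected in the same group, hence equal. *)
suff <- : e = e %/ k * k + b (e %/ k) %% k by [].
rewrite -{1}h6 -divn_eq.
apply: (sum_nat_le1 (y1 _ lti)) => //; rewrite ?h2 ?h5 hits_group //=.
by rewrite h6.
Qed.

(** * From 3-SAT to the selection problem *)

Definition block_step n a := if a * 2 ^ a < n then a.+1 else a.

(* The least positive [L] with [n <= L * 2 ^ L]. *)
Definition block n := iter n (block_step n) 1.

Lemma block_step_le n i : iter i (block_step n) 1 <= i.+1.
Proof.
elim: i => //= i; move: (iter i _ 1) => a IH.
by rewrite /block_step; case: ifP => _; lia.
Qed.

Lemma block_gt0 n : 0 < block n.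
Proof.
rewrite /block; elim: {1}n => //= i; move: (iter i _ 1) => a IH.
by rewrite /block_step; case: ifP.
Qed.

(** Every step increments as long as the bound fails, so after [i] steps either the bound holds or
    the value is [i.+1]; the value [n.+1] is large enough. *)
Lemma block_ge n : n <= block n * 2 ^ block n.
Proof.
have inv i : n <= iter i (block_step n) 1 * 2 ^ iter i (block_step n) 1
    \/ iter i (block_step n) 1 = i.+1.
  elim: i => [|i]; first by right.
  rewrite /=; move: (iter i _ 1) => a IH; rewrite /block_step.
  case: ltnP; last by left.
  by case: IH => [|->]; [lia | right].
rewrite /block; have [//|->] := inv n; apply: leq_trans (leqnSn n) _.
by rewrite leq_pmulr // expn_gt0.
Qed.

Lemma block_min n : block n = 1 \/ (block n).-1 * 2 ^ (block n).-1 < n.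
Proof.
suff inv i (a := iter i (block_step n) 1) : a = 1 \/ a.-1 * 2 ^ a.-1 < n.
  exact: (inv n).
rewrite /a; elim: i {a} => [|i]; first by left.
rewrite /=; move: (iter i _ 1) => a IH.
by rewrite /block_step; case: ifP => //; right.
Qed.

(** For L >= 2, minimality gives 2^(L-1) <= (L-1) 2^(L-1) < n. This keeps the group size linear in
    n. *)
Lemma pow_block_le n : 2 ^ block n <= 2 * n + 2.
Proof.
have [->|lt] := block_min n; first by lia.
have := block_gt0 n; case: (block n) lt => // -[|b] lt _; first by lia.
rewrite expnS; move: lt; rewrite /= mulSn; lia.
Qed.

(** Element [e] is the assignment with binary code [e %% k] in group [e %/ k]. The variable v =
    [l./2] is bit [v %% L] of group [v %/ L], and [odd l] is the sign of the literal. *)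
Definition lit_hits L k l e : bool :=
  (e %/ k == l./2 %/ L) && (odd (e %% k %/ 2 ^ (l./2 %% L)) == odd l).

(* Constraint [c < k] asks for an element of the [c]-th group of variables, that
   is, an assignment of these variables; constraint [k + c] is the [c]-th
   clause, whose literals are given by [lits]. *)
Definition hits L k (lits : nat -> nat) c e : bool :=
  if c < k then e %/ k == c
  else [|| lit_hits L k (lits (3 * (c - k))) e,
           lit_hits L k (lits (3 * (c - k)).+1) e
         | lit_hits L k (lits (3 * (c - k)).+2) e].

Lemma sum_group_le k c : \sum_(0 <= e < k * k) (e %/ k == c) <= k.
Proof.
rewrite sum_nat_divmod.
have [->|k0] := posnP k; first by rewrite big_geq.
have -> : \sum_(0 <= i < k) \sum_(0 <= j < k) ((i * k + j) %/ k == c) =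
    \sum_(0 <= i < k) (i == c) * k.
  apply: eq_bigr => i _.
  have -> : (i == c) * k = \sum_(0 <= j < k) (i == c).
    by rewrite sum_nat_const_nat subn0 mulnC.
  by apply: eq_big_nat => j /andP[_ ltj]; rewrite divnMDl // divn_small ?addn0.
rewrite -big_distrl /=.
have [ltc|lec] := ltnP c k.
  rewrite big_mkord (bigD1 (Ordinal ltc)) //= eqxx big1 ?addn0 ?mul1n //.
  by move=> i; rewrite -val_eqE /= => /negbTE->.
rewrite big1_seq ?mul0n // => i; rewrite mem_index_iota /= => lti.
by case: eqP => //; lia.
Qed.

(** All elements hit by a literal lie in the group of its variable, so there are at most k of them,
    and a clause has three literals. *)
Lemma sum_hits_le L k lits c : \sum_(0 <= e < k * k) hits L k lits c e <= 3 * k.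
Proof.
rewrite /hits; case: (c < k).
  by apply: leq_trans (sum_group_le k c) _; lia.
have lit l : \sum_(0 <= e < k * k) lit_hits L k l e <= k.
  apply: leq_trans (sum_group_le k (l./2 %/ L)).
  by apply: leq_sum => e _; rewrite /lit_hits; case: (_ == _) => //; case: (_ == _).
move: (lits (3 * (c - k))) (lits (3 * (c - k)).+1) (lits (3 * (c - k)).+2) => l1 l2 l3.
apply: leq_trans (_ : \sum_(0 <= e < k * k) (lit_hits L k l1 e + lit_hits L k l2 e
   + lit_hits L k l3 e) <= _).
  by apply: leq_sum => e _; do 3!case: (lit_hits _ _ _ e).
rewrite !big_split /=; have := lit l1; have := lit l2; have := lit l3; lia.
Qed.

(** This is why the [2 ^ L] elements of a group exhaust the assignments of its variables. *)
Lemma exists_bits (f : nat -> bool) L :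
  exists2 a, a < 2 ^ L & forall j, j < L -> odd (a %/ 2 ^ j) = f j.
Proof.
elim: L f => [|L IH] f; first by exists 0.
have [a lta ha] := IH (fun j => f j.+1); exists (f 0 + a.*2).
  by rewrite expnS; case: (f 0); lia.
case=> [|j] ltj; first by rewrite divn1 oddD odd_double addbF; case: (f 0).
by rewrite expnS divnMA divn2 half_bit_double ha.
Qed.

Lemma half_lit_code n (l : literal n) : (lit_code l)./2 = val l.1.
Proof. by rewrite /lit_code addnC half_bit_double. Qed.

Lemma odd_lit_code n (l : literal n) : odd (lit_code l) = l.2.
Proof. by rewrite /lit_code oddD odd_double; case: l.2. Qed.

(** The shift by 2 skips the numbers of variables and clauses. *)
Definition cnf_lits (phi : cnf3) (i : nat) : nat := nth 0 (encode_cnf3 phi) i.+2.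

Lemma cnf_litsE (phi : cnf3) C0 c : c < size (clauses phi) ->
  let C := nth C0 (clauses phi) c in
  [/\ cnf_lits phi (3 * c) = lit_code C.1.1,
      cnf_lits phi (3 * c).+1 = lit_code C.1.2
    & cnf_lits phi (3 * c).+2 = lit_code C.2].
Proof.
rewrite /cnf_lits /=; elim: (clauses phi) c => [//|C s IH] [//|c] ltc.
have -> : 3 * c.+1 = (3 * c).+3 by lia.
exact: IH.
Qed.

Lemma sat_selectable phi (L := block (nvars phi)) (k := 2 ^ L) :
  satisfiable phi <->
  selectable k (hits L k (cnf_lits phi)) (size (clauses phi)).
Proof.
have L0 : 0 < L := block_gt0 _.
have k0 : 0 < k by rewrite expn_gt0.
(* By [n <= L * 2 ^ L], the k groups of L positions hold all the variables. *)
have lt_group (v : 'I_(nvars phi)) : v %/ L < k.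
  rewrite ltn_divLR //; apply: leq_trans (ltn_ord v) _.
  by rewrite mulnC; apply: block_ge.
have hit_iff (l : literal (nvars phi)) i a : a < k ->
    lit_hits L k (lit_code l) (i * k + a) =
    (i == l.1 %/ L) && (odd (a %/ 2 ^ (l.1 %% L)) == l.2).
  move=> lta; rewrite /lit_hits half_lit_code odd_lit_code.
  by rewrite divnMDl // modnMDl divn_small // modn_small // addn0.
split=> [[al sat]|[a lta ha]].
(* Positions of the groups that carry no variable get the value [false]. *)
- pose f v := if insub v is Some i then al i else false.
  have fE (v : 'I_(nvars phi)) : f v = al v by rewrite /f valK.
  have [a lta ha] : exists2 a : nat -> nat, forall i, a i < k &
      forall i j, j < L -> odd (a i %/ 2 ^ j) = f (i * L + j).
    have ex i : exists a, a < k /\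
        forall j, j < L -> odd (a %/ 2 ^ j) = f (i * L + j).
      by have [a] := exists_bits (fun j => f (i * L + j)) L; exists a.
    by have [a ha] := choice ex; exists a => i; have [] := ha i.
  exists a => [i _|c /andP[lec ltc]]; first exact: lta.
  have lt_c : c - k < size (clauses phi) by lia.
  have C0 : clause3 (nvars phi) by case: (clauses phi) lt_c.
  have [e1 e2 e3] := cnf_litsE C0 lt_c.
  have /allP/(_ _ (mem_nth C0 lt_c)) := sat.
  rewrite /hits ltnNge lec /= e1 e2 e3.
  have true_hits (l : literal (nvars phi)) : lit_true al l ->
      lit_hits L k (lit_code l) (l.1 %/ L * k + a (l.1 %/ L)).
    move=> /eqP lt; rewrite hit_iff // eqxx ha ?ltn_mod //.
    by rewrite -divn_eq fE lt eqxx.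
  set C := nth _ _ _.
  by case/or3P => /true_hits h; [exists (C.1.1.1 %/ L) | exists (C.1.2.1 %/ L)
    | exists (C.2.1 %/ L)]; rewrite ?lt_group // h ?orbT.
- exists (fun v => odd (a (v %/ L) %/ 2 ^ (v %% L))).
  apply/allP => C Cin.
  have lt_c : index C (clauses phi) < size (clauses phi) by rewrite index_mem.
  have [e1 e2 e3] := cnf_litsE C lt_c; rewrite nth_index // in e1 e2 e3.
  have [|i lti] := ha (k + index C (clauses phi)).
    by rewrite leq_addr ltn_add2l.
  rewrite /hits ltnNge leq_addr /= addKn e1 e2 e3 !hit_iff ?lta //.
  rewrite /clause_true /lit_true.
  by case/or3P=> /andP[/eqP<- ->]; rewrite ?orbT.
Qed.

(** * The reduced instance, its encoding and its size *)

Definition group_size phi := 2 ^ block (nvars phi).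
Definition cnf_hits phi := hits (block (nvars phi)) (group_size phi) (cnf_lits phi).
Definition cnf_order phi := order (group_size phi) (size (clauses phi)).
Definition cnf_adj phi := adj (group_size phi) (cnf_hits phi).

Lemma group_size_gt1 phi : 1 < group_size phi.
Proof. by rewrite (ltn_exp2l 0) // block_gt0. Qed.

Lemma bound_gt0 phi : 1 <= 4 * group_size phi.
Proof. by have := group_size_gt1 phi; lia. Qed.

Definition reduce phi : oa_instance :=
  @OAInstance (cnf_order phi)
    (adj_graph (group_size phi) (cnf_hits phi) (size (clauses phi)))
    (4 * group_size phi) (bound_gt0 phi).

Lemma reduce_yes phi : oa_yes (reduce phi) <-> satisfiable phi.
Proof.
rewrite sat_selectable; split.
- apply: alliance_selection => [|c e ltc|c _]; first exact: group_size_gt1.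
    by rewrite /cnf_hits /hits ifT.
  exact: sum_hits_le.
- apply: selection_alliance => [|c e ltc|c _]; first exact: group_size_gt1.
    by rewrite /cnf_hits /hits ifT.
  exact: sum_hits_le.
Qed.

(** Row-major order puts entry (u, v) at position u N + v, so a program can recover the entry from
    its address by division. *)
Lemma allpairs_iota (f : nat -> nat -> nat) M N : 0 < N ->
  [seq f u v | u <- iota 0 M, v <- iota 0 N]
    = mkseq (fun j => f (j %/ N) (j %% N)) (M * N).
Proof.
move=> N0; elim: M => // M IH.
rewrite -addn1 iotaD allpairs_cat IH mulnDl mul1n /mkseq iotaD map_cat; congr cat.
rewrite /= cats0 !add0n -[M * N in RHS]addn0 iotaDl -map_comp.
apply/eq_in_map => j; rewrite mem_iota /= => ltj.
by rewrite divnMDl // modnMDl divn_small // modn_small // addn0.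
Qed.

Lemma encode_reduce phi : encode_oa (reduce phi) =
  cnf_order phi :: 4 * group_size phi ::
    mkseq (fun j => cnf_adj phi (j %/ cnf_order phi) (j %% cnf_order phi) : nat)
      (cnf_order phi * cnf_order phi).
Proof.
rewrite /encode_oa /=; do 2!congr cons.
have [N0|N0] := posnP (cnf_order phi).
  by have := group_size_gt1 phi; move: N0; rewrite /cnf_order /order; lia.
rewrite -(allpairs_iota (fun u v => cnf_adj phi u v)) // -val_enum_ord.
by rewrite allpairs_mapl allpairs_mapr.
Qed.

Lemma init_encode_reduce phi (N := cnf_order phi) :
  init_state (encode_oa (reduce phi)) =
  State (fun j => if j == 0 then N * N + 2 else 0)
    (fun a => if a == 0 then N else if a == 1 then 4 * group_size phi
     else if a - 2 < N * N then cnf_adj phi ((a - 2) %/ N) ((a - 2) %% N) : nat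
     else 0).
Proof.
rewrite /init_state encode_reduce /= size_mkseq addn2; congr State.
apply/funext => -[|[|a]] //=.
have -> : a.+2 - 2 = a by lia.
case: ltnP => h; first by rewrite nth_mkseq.
by rewrite nth_default // size_mkseq.
Qed.

(** The scale [X] of all time bounds; the summand 16 makes small constants at most [X]. *)
Definition cnf_size phi := nvars phi + size (clauses phi) + 16.

Lemma cnf_size_gt1 phi : 1 < cnf_size phi.
Proof. by rewrite /cnf_size; lia. Qed.

Lemma block_le phi : block (nvars phi) <= cnf_size phi.
Proof.
by apply: leq_trans (block_step_le _ _) _; rewrite /cnf_size; lia.
Qed.

Lemma group_size_le phi : group_size phi <= cnf_size phi ^ 2.
Proof.
apply: leq_trans (pow_block_le _) _.
have -> : cnf_size phi ^ 2 = cnf_size phi * cnf_size phi by [].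
by rewrite /cnf_size; nia.
Qed.

Lemma cnf_order_le phi : cnf_order phi <= cnf_size phi ^ 5.
Proof.
have := group_size_le phi; set k := group_size phi => lek.
have -> : cnf_order phi = k * k + 12 * k + 2 + size (clauses phi).
  by rewrite /cnf_order /order /off_constr /off_elem /off_forced -/k; lia.
have lem : size (clauses phi) <= cnf_size phi by rewrite /cnf_size; lia.
have leX : 16 <= cnf_size phi by rewrite /cnf_size; lia.
have : k * k <= cnf_size phi ^ 4 by rewrite (expnD _ 2 2); apply: leq_mul.
move: (cnf_size phi) lek lem leX => X lek lem leX lekk.
have h3 : 12 * k <= X ^ 3 by rewrite (expnD X 1 2); apply: leq_mul => //; lia.
have l34 : X ^ 3 <= X ^ 4 by apply: leq_pexp2l; lia.
have l14 : X ^ 1 <= X ^ 4 by apply: leq_pexp2l; lia.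
have l54 : X ^ 5 = X * X ^ 4 by rewrite expnS.
have := leq_mul leX (leqnn (X ^ 4)); rewrite -l54 {l54}; move: l14; rewrite expn1.
lia.
Qed.

Lemma lit_code_le n (l : literal n) : lit_code l <= 2 * n.
Proof. by case: l => -[v ltv] []; rewrite /lit_code /=; lia. Qed.

Lemma cnf_lits_le phi i : cnf_lits phi i <= 2 * nvars phi.
Proof.
rewrite /cnf_lits /=.
by elim: (clauses phi) i => [|C s IH] [|[|[|i]]] //=; apply: lit_code_le.
Qed.

(** * The reduction on the RAM *)

(** The input is copied beyond both the input and the output, so that the output can overwrite the
    original. *)
Definition copy_base phi :=
  cnf_order phi * cnf_order phi + 2 + size (encode_cnf3 phi).

(* Register 0 holds the length of the input; registers 1 and 2 hold the numbers
   of variables and clauses, which are needed only for the ones below. *)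
Record ready phi (D : nat) (s : state) : Prop := Ready {
  ready_depth : 8 <= D;
  ready_len : reg s 0 = size (encode_cnf3 phi);
  ready_block : reg s 3 = block (nvars phi);
  ready_group : reg s 4 = group_size phi;
  ready_order : reg s 5 = cnf_order phi;
  ready_cells : reg s 6 = cnf_order phi * cnf_order phi;
  ready_base : reg s 7 = copy_base phi;
  ready_lits : forall i, i < 3 * size (clauses phi) ->
    memory s (copy_base phi + i.+2) = cnf_lits phi i }.

Lemma ready_agree phi D D1 s s1 :
  ready phi D s -> D <= D1 -> agree D s s1 -> ready phi D1 s1.
Proof.
case=> hD h0 h3 h4 h5 h6 h7 hl leD [rg mem].
by split; rewrite ?mem ?rg //; lia.
Qed.

Definition elit_hits (l e : nat -> cmd) : nat -> cmd :=
  eand (eeq (ediv e (evar 4)) (ediv (ediv l (econst 2)) (evar 3)))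
    (eeq (emod (ediv (emod e (evar 4)) (epow2 (emod (ediv l (econst 2)) (evar 3))))
            (econst 2))
       (emod l (econst 2))).

(** The exponent is fixed before the formula, so the bound is uniform; [eexists] lets the combinator
    lemmas determine it. *)
Lemma ev_lit_hits pl pe : exists p, forall phi D s l e vl ve (X := cnf_size phi),
  ready phi D s -> evaluates X l D s vl pl -> evaluates X e D s ve pe ->
  vl <= X ^ 5 -> ve <= X ^ 5 ->
  evaluates X (elit_hits l e) D s
    (lit_hits (block (nvars phi)) (group_size phi) vl ve) p.
Proof.
eexists => phi D s l e vl ve X rd hl he lel lee.
have X1 : 1 < X := cnf_size_gt1 phi.
have D8 := ready_depth rd.
have hL : evaluates X (evar 3) D s (block (nvars phi)) 1.
  by apply: ev_varE; rewrite ?(ready_block rd) //; lia.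
have hk : evaluates X (evar 4) D s (group_size phi) 1.
  by apply: ev_varE; rewrite ?(ready_group rd) //; lia.
have h2 : evaluates X (econst 2) D s 2 0 by apply: ev_const.
have L0 := block_gt0 (nvars phi).
have leL : block (nvars phi) <= X ^ 1 := block_le phi.
have k0 : 0 < group_size phi by have := group_size_gt1 phi; lia.
have lek : group_size phi <= X ^ 2 := group_size_le phi.
have le2 : 2 <= X ^ 1 := X1.
have hv := ev_div X1 hl h2 isT lel le2; rewrite divn2 in hv.
have lev : vl./2 <= X ^ 5 by lia.
have hg := ev_div X1 hv hL L0 lev leL.
have hm := ev_mod X1 hv hL L0 lev leL.
have ltm : vl./2 %% block (nvars phi) < block (nvars phi) by rewrite ltn_mod.
have hp := ev_pow2 X1 hm (leq_trans (ltnW ltm) leL).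
have p0 : 0 < 2 ^ (vl./2 %% block (nvars phi)) by rewrite expn_gt0.
have lep : 2 ^ (vl./2 %% block (nvars phi)) <= X ^ 2.
  by apply: leq_trans lek; rewrite leq_exp2l // ltnW.
have heg := ev_div X1 he hk k0 lee lek.
have hek := ev_mod X1 he hk k0 lee lek.
have leek : ve %% group_size phi <= X ^ 5 by apply: leq_trans (leq_mod _ _) lee.
have hb := ev_div X1 hek hp p0 leek lep.
have leb : ve %% group_size phi %/ 2 ^ (vl./2 %% block (nvars phi)) <= X ^ 5.
  exact: leq_trans (leq_div _ _) leek.
have ho := ev_mod X1 hb h2 isT leb le2; rewrite modn2 in ho.
have hol := ev_mod X1 hl h2 isT lel le2; rewrite modn2 in hol.
apply: ev_eq (ev_and X1 (ev_eqn X1 heg hg) (fun=> ev_eqn X1 ho hol)).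
by rewrite /lit_hits; case: (odd vl); case: odd.
Qed.

(** [t] is 2, 3 or 4: the two header cells plus the position of the literal in its clause. *)
Definition elit (c : nat -> cmd) t : nat -> cmd :=
  eload (eadd (eadd (evar 7) (econst t)) (emul (econst 3) (esub c (evar 4)))).

Lemma ev_lit pc t : exists p, forall phi D s c vc (X := cnf_size phi),
  ready phi D s -> evaluates X c D s vc pc ->
  group_size phi <= vc < group_size phi + size (clauses phi) -> 2 <= t < 5 ->
  evaluates X (elit c t) D s (cnf_lits phi (3 * (vc - group_size phi) + (t - 2))) p.
Proof.
eexists => phi D s c vc X rd hc /andP[lec ltc] ht.
have X1 : 1 < X := cnf_size_gt1 phi.
have D8 := ready_depth rd.
have hk : evaluates X (evar 4) D s (group_size phi) 1.
  by apply: ev_varE; rewrite ?(ready_group rd) //; lia.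
have hB : evaluates X (evar 7) D s (copy_base phi) 1.
  by apply: ev_varE; rewrite ?(ready_base rd) //; lia.
have le1 : vc - group_size phi <= X ^ 1 by rewrite expn1 /X /cnf_size; lia.
have hm := ev_mul X1 (@ev_const X D s 3 X1) (ev_sub X1 hc hk) le1.
apply: ev_eq (ev_load X1 (ev_add X1 (ev_add X1 hB (@ev_const X D s t X1)) hm)).
rewrite -(ready_lits rd); last by lia.
by congr memory; lia.
Qed.

Definition ehits (c e : nat -> cmd) : nat -> cmd :=
  eif (elt c (evar 4)) (eeq (ediv e (evar 4)) c)
    (eor (elit_hits (elit c 2) e)
      (eor (elit_hits (elit c 3) e) (elit_hits (elit c 4) e))).

Lemma ev_hits pc pe : exists p, forall phi D s c e vc ve (X := cnf_size phi),
  ready phi D s -> evaluates X c D s vc pc -> evaluates X e D s ve pe ->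
  vc < group_size phi + size (clauses phi) -> ve <= X ^ 5 ->
  evaluates X (ehits c e) D s (cnf_hits phi vc ve) p.
Proof.
have [p2 h2] := ev_lit pc 2; have [p3 h3] := ev_lit pc 3.
have [p4 h4] := ev_lit pc 4.
have [q2 g2] := ev_lit_hits p2 pe; have [q3 g3] := ev_lit_hits p3 pe.
have [q4 g4] := ev_lit_hits p4 pe.
eexists => phi D s c e vc ve X rd hc he ltc lee.
have X1 : 1 < X := cnf_size_gt1 phi.
have D8 := ready_depth rd.
have hk : evaluates X (evar 4) D s (group_size phi) 1.
  by apply: ev_varE; rewrite ?(ready_group rd) //; lia.
have k0 : 0 < group_size phi by have := group_size_gt1 phi; lia.
have lek : group_size phi <= X ^ 2 := group_size_le phi.
rewrite /cnf_hits /hits.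
apply: (ev_if X1 (ev_lt X1 hc hk)).
  case: ltnP => // lt _; exact: (ev_eqn X1 (ev_div X1 he hk k0 lee lek) hc).
case: ltnP => // gec _.
have hvc : group_size phi <= vc < group_size phi + size (clauses phi) by rewrite gec.
have le5 i : cnf_lits phi i <= X ^ 5.
  apply: leq_trans (cnf_lits_le phi i) _.
  apply: leq_trans (_ : X ^ 2 <= _); last by apply: leq_pexp2l => //; lia.
  have -> : X ^ 2 = X * X by [].
  by rewrite /X /cnf_size; nia.
have e2 := h2 phi D s c vc rd hc hvc isT; have e3 := h3 phi D s c vc rd hc hvc isT.
have e4 := h4 phi D s c vc rd hc hvc isT.
rewrite addn0 in e2; rewrite addn1 in e3; rewrite addn2 in e4.
exact: (ev_or X1 (g2 phi D s _ e _ ve rd e2 he (le5 _) lee)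
  (fun=> ev_or X1 (g3 phi D s _ e _ ve rd e3 he (le5 _) lee)
  (fun=> g4 phi D s _ e _ ve rd e4 he (le5 _) lee))).
Qed.

Definition epad (c : nat -> cmd) : nat -> cmd :=
  esub (eadd (emul (econst 3) (evar 4)) (econst 1))
    (esum (emul (evar 4) (evar 4)) (fun i => ehits c (evar i))).

Lemma ev_pad pc : exists p, forall phi D s c vc (X := cnf_size phi),
  ready phi D s -> evaluates X c D s vc pc ->
  vc < group_size phi + size (clauses phi) ->
  evaluates X (epad c) D s (pad (group_size phi) (cnf_hits phi) vc) p.
Proof.
have [p h] := ev_hits pc 1.
eexists => phi D s c vc X rd hc ltc.
have X1 : 1 < X := cnf_size_gt1 phi.
have D8 := ready_depth rd.
have hk : evaluates X (evar 4) D s (group_size phi) 1.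
  by apply: ev_varE; rewrite ?(ready_group rd) //; lia.
have lek : group_size phi <= X ^ 2 := group_size_le phi.
have lekk : group_size phi * group_size phi <= X ^ 4.
  by rewrite (expnD X 2 2); apply: leq_mul.
have le45 : X ^ 4 <= X ^ 5 by apply: leq_pexp2l => //; lia.
rewrite /pad big_mkord.
apply: (ev_sub X1 (ev_add X1 (ev_mul X1 (@ev_const X D s 3 X1) hk lek) (@ev_const X D s 1 X1))).
apply: (ev_sum (f := fun e => cnf_hits phi vc e : nat) X1 (ev_mul X1 hk hk lek) lekk).
move=> i d s1 lti led ag rd1.
apply: h => //; [exact: (ready_agree rd (leqW led) ag)
  | exact: (ev_weaken hc (leqW led) ag) | exact: ev_varE | lia].
Qed.

Definition eoff_forced : nat -> cmd := eadd (emul (econst 8) (evar 4)) (econst 2).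
Definition eoff_elem : nat -> cmd := eadd eoff_forced (emul (econst 3) (evar 4)).
Definition eoff_constr : nat -> cmd := eadd eoff_elem (emul (evar 4) (evar 4)).

Lemma ev_offsets : exists p, forall X D s k,
  1 < X -> 4 < D -> reg s 4 = k -> k <= X ^ 2 ->
  [/\ evaluates X eoff_forced D s (off_forced k) p,
      evaluates X eoff_elem D s (off_elem k) p
    & evaluates X eoff_constr D s (off_constr k) p].
Proof.
eexists => X D s k X1 D4 rk lek.
have hk : evaluates X (evar 4) D s k 1 by apply: ev_varE.
have h1 := ev_add X1 (ev_mul X1 (@ev_const X D s 8 X1) hk lek) (@ev_const X D s 2 X1).
have h2 := ev_add X1 h1 (ev_mul X1 (@ev_const X D s 3 X1) hk lek).
have h3 := ev_add X1 h2 (ev_mul X1 hk hk lek).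
have X0 := ltnW X1.
split; [apply: (ev_exponent X0 _ h1) | apply: (ev_exponent X0 _ h2) | exact: h3]; lia.
Qed.

Definition ehalf_adj (u v : nat -> cmd) : nat -> cmd :=
  eif (elt v eoff_forced) (elt u v)
  (eif (elt v eoff_constr) (econst 0)
  (eif (elt u eoff_forced) (elt u (epad (esub v eoff_constr)))
  (eif (elt u eoff_elem) (econst 1)
  (eif (elt u eoff_constr) (ehits (esub v eoff_constr) (esub u eoff_elem))
  (econst 0))))).

Lemma ev_half_adj pu pv : exists p, forall phi D s u v vu vv (X := cnf_size phi),
  ready phi D s -> evaluates X u D s vu pu -> evaluates X v D s vv pv ->
  vu < cnf_order phi -> vv < cnf_order phi ->
  evaluates X (ehalf_adj u v) D s
    (half_adj (group_size phi) (cnf_hits phi) vu vv) p.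
Proof.
have [po ho] := ev_offsets.
have [pp hp] := ev_pad (pv + po + 2).
have [ph hh] := ev_hits (pv + po + 2) (pu + po + 2).
eexists => phi D s u v vu vv X rd hu hv ltu ltv.
have X1 : 1 < X := cnf_size_gt1 phi.
have D8 := ready_depth rd.
have D4 : 4 < D by lia.
have [hF hE hC] := ho X D s _ X1 D4 (ready_group rd) (group_size_le phi).
have const (b : bool) : evaluates X (econst b) D s b 0 by apply: ev_const.
have leu : vu <= X ^ 5 by apply: leq_trans (cnf_order_le phi); apply: ltnW.
rewrite /half_adj.
apply: (ev_if X1 (ev_lt X1 hv hF)); case: ltnP => // h1 _; first exact: (ev_lt X1 hu hv).
apply: (ev_if X1 (ev_lt X1 hv hC)); case: ltnP => // h2 _; first exact: (const false).
have ltc : vv - off_constr (group_size phi) < group_size phi + size (clauses phi).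
  by move: ltv; rewrite /cnf_order /order; lia.
have hc := ev_sub X1 hv hC.
apply: (ev_if X1 (ev_lt X1 hu hF)); case: ltnP => // h3 _.
  exact: (ev_lt X1 hu (hp phi D s _ _ rd hc ltc)).
apply: (ev_if X1 (ev_lt X1 hu hE)); case: ltnP => // h4 _; first exact: (const true).
apply: (ev_if X1 (ev_lt X1 hu hC)); case: ltnP => // h5 _; last exact: (const false).
apply: (hh phi D s _ _ _ _ rd hc (ev_sub X1 hu hE) ltc).
exact: leq_trans (leq_subr _ _) leu.
Qed.

Definition eadj (j : nat) : nat -> cmd :=
  elet (ediv (evar j) (evar 5)) (fun u => elet (emod (evar j) (evar 5)) (fun v =>
    eor (ehalf_adj (evar u) (evar v)) (ehalf_adj (evar v) (evar u)))).

Lemma ev_adj : exists p, forall phi D s j (X := cnf_size phi) (N := cnf_order phi),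
  ready phi D s -> j < D -> reg s j < N * N ->
  evaluates X (eadj j) D s (cnf_adj phi (reg s j %/ N) (reg s j %% N)) p.
Proof.
have [p h] := ev_half_adj 1 1.
eexists => phi D s j X N rd ltj ltN.
have X1 : 1 < X := cnf_size_gt1 phi.
have D8 := ready_depth rd.
have N0 : 0 < N by move: ltN; case: N.
have leN : N <= X ^ 5 := cnf_order_le phi.
have leN2 : reg s j <= X ^ 10.
  by apply: leq_trans (ltnW ltN) _; rewrite (expnD X 5 5); apply: leq_mul.
have hN : evaluates X (evar 5) D s N 1.
  by apply: ev_varE; rewrite ?(ready_order rd) //; lia.
have hj : evaluates X (evar j) D s (reg s j) 1 by apply: ev_var.
apply: (ev_let X1 (ev_div X1 hj hN N0 leN2 leN)) => d1 s1 led1 ag1 r1.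
have hm := ev_mod X1 hj hN N0 leN2 leN.
apply: (ev_let X1 (ev_weaken hm (leqW led1) ag1)) => d2 s2 led2 ag2 r2.
have rd1 := ready_agree rd (leqW led1) ag1.
have rd2 := ready_agree rd1 (leqW led2) ag2.
have hu : evaluates X (evar d1) d2.+1 s2 (reg s j %/ N) 1.
  by apply: ev_varE => //; [lia | rewrite ag2.1 ?r1 //; lia].
have hv : evaluates X (evar d2) d2.+1 s2 (reg s j %% N) 1 by apply: ev_varE.
have ltu : reg s j %/ N < N by rewrite ltn_divLR.
have ltv : reg s j %% N < N by rewrite ltn_mod.
exact: (ev_or X1 (h phi _ _ _ _ _ _ rd2 hu hv ltu ltv)
  (fun=> h phi _ _ _ _ _ _ rd2 hv hu ltv ltu)).
Qed.

(** The factors are ordered so that the multiplication loops [acc] times, not [2 ^ acc] times. *)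
Definition eblock : nat -> cmd :=
  eloop (econst 1) (evar 1) (fun acc _ =>
    eif (elt (emul (epow2 (evar acc)) (evar acc)) (evar 1))
      (eadd (evar acc) (econst 1)) (evar acc)).

Lemma ev_block : exists p, forall X D s n,
  1 < X -> 1 < D -> reg s 1 = n -> n < X -> evaluates X eblock D s (block n) p.
Proof.
eexists => X D s n X1 D1 rn ltn.
rewrite /block -{1}(subn0 n).
have len : n <= X ^ 1 by apply: ltnW.
apply: (ev_loop (n := n) (g := fun i => iter (n - i) (block_step n) 1) X1 _ _ len).
- by rewrite subnn; apply: ev_const.
- exact: ev_varE.
move=> i d s1 lti led ag rd _.
have -> : n - i = (n - i.+1).+1 by lia.
rewrite iterS; set a := iter (n - i.+1) _ _ in rd *.
have lea : a <= X ^ 1.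
  by apply: leq_trans (block_step_le _ _) _; rewrite expn1; lia.
have ha : evaluates X (evar d) d.+2 s1 a 1 by apply: ev_varE.
have hn : evaluates X (evar 1) d.+2 s1 n 1.
  by apply: ev_varE => //; rewrite ag.1.
apply: (ev_if X1 (ev_lt X1 (ev_mul X1 (ev_pow2 X1 ha lea) ha lea) hn)).
  rewrite /block_step (mulnC a); case: ltnP => // _ _.
  exact: (ev_eq (addn1 a) (ev_add X1 ha (@ev_const X _ s1 1 X1))).
rewrite /block_step (mulnC a); case: ltnP => // _ _; exact: ha.
Qed.

Lemma size_encode_cnf3 phi : size (encode_cnf3 phi) = 2 + 3 * size (clauses phi).
Proof.
rewrite /encode_cnf3 /= -addn2 addnC; congr (2 + _).
by elim: (clauses phi) => //= C s ->; lia.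
Qed.

(** Compiling an expression at register i acts as an assignment to register i. *)
Definition prelude : cmd :=
  Seq (eload (econst 0) 1) (Seq (eload (econst 1) 2) (Seq (eblock 3)
  (Seq (epow2 (evar 3) 4) (Seq (eadd eoff_constr (eadd (evar 4) (evar 2)) 5)
  (Seq (emul (evar 5) (evar 5) 6)
    (eadd (eadd (evar 6) (econst 2)) (evar 0) 7)))))).

Lemma runs_prelude : exists p, forall phi (s := init_state (encode_cnf3 phi)),
  exists s', [/\ runs (cnf_size phi) prelude s s' p,
    memory s' = memory s, reg s' 0 = size (encode_cnf3 phi)
  & [/\ reg s' 3 = block (nvars phi), reg s' 4 = group_size phi,
        reg s' 5 = cnf_order phi, reg s' 6 = cnf_order phi * cnf_order phi
      & reg s' 7 = copy_base phi]].
Proof.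
have [pb hb] := ev_block; have [po ho] := ev_offsets.
eexists => phi s.
set X := cnf_size phi.
have X1 : 1 < X := cnf_size_gt1 phi.
have [s1 [c1 r1 a1]] :=
  runs_assign (ev_load X1 (@ev_const X 1 s 0 X1)).
have [s2 [c2 r2 a2]] :=
  runs_assign (ev_load X1 (@ev_const X 2 s1 1 X1)).
have r12 : reg s2 1 = nvars phi by rewrite a2.1 ?r1.
have ltn : nvars phi < X by rewrite /X /cnf_size; lia.
have [s3 [c3 r3 a3]] := runs_assign (hb X 3 s2 _ X1 isT r12 ltn).
have [s4 [c4 r4 a4]] := runs_assign
  (ev_pow2 X1 (@ev_varE X 4 s3 3 _ X1 isT r3) (block_le phi : _ <= X ^ 1)).
have [_ _ hC] := ho X 5 s4 _ X1 isT r4 (group_size_le phi).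
have r24 : reg s4 2 = size (clauses phi) by rewrite a4.1 ?a3.1 ?r2 ?a1.2.
have [s5 [c5 r5 a5]] := runs_assign (ev_add X1 hC
  (ev_add X1 (@ev_varE X 5 s4 4 _ X1 isT r4) (@ev_varE X 5 s4 2 _ X1 isT r24))).
rewrite -/(order (2 ^ block (nvars phi)) (size (clauses phi))) in r5.
rewrite -/(group_size phi) -/(cnf_order phi) in r5.
have h5 := @ev_varE X 6 s5 5 _ X1 isT r5.
have [s6 [c6 r6 a6]] := runs_assign (ev_mul X1 h5 h5 (cnf_order_le phi)).
have r06 : reg s6 0 = size (encode_cnf3 phi).
  by rewrite a6.1 ?a5.1 ?a4.1 ?a3.1 ?a2.1 ?a1.1.
have [s7 [c7 r7 a7]] := runs_assign (ev_add X1
  (ev_add X1 (@ev_varE X 7 s6 6 _ X1 isT r6) (@ev_const X 7 s6 2 X1))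
  (@ev_varE X 7 s6 0 _ X1 isT r06)).
exists s7; split; first by do 6!(apply: (runs_seq X1); first eassumption); eassumption.
- by rewrite a7.2 a6.2 a5.2 a4.2 a3.2 a2.2 a1.2.
- by rewrite a7.1.
- split=> //.
  + by rewrite a7.1 // a6.1 // a5.1 // a4.1.
  + by rewrite a7.1 // a6.1 // a5.1.
  + by rewrite a7.1 // a6.1.
  + by rewrite a7.1.
Qed.

(** In order: save the input, write the matrix, erase the saved copy, write the two header cells,
    and put the output length into register 0. The erasure is needed because an initial state is 0
    beyond its word. *)
Definition reduction_body : cmd :=
  Seq prelude
  (Seq (fill (evar 7) (evar 0) (fun j => eload (evar j)) 8)
  (Seq (fill (econst 2) (evar 6) eadj 8)
  (Seq (fill (evar 7) (evar 0) (fun=> econst 0) 8)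
  (Seq (fill (econst 0) (econst 2)
          (fun j => eif (evar j) (emul (econst 4) (evar 4)) (evar 5)) 8)
  (Seq (eadd (evar 6) (econst 2) 8) (Seq (Const 0 0) (Add 0 0 8))))))).

Definition reduction_cmd : cmd :=
  Seq reduction_body (clear_regs (reg_bound reduction_body)).

(** The alliance algorithm must start in a genuine initial state. Registers above the cleared range
    were never written and are still 0. *)
Lemma exec_clear_written c w t s : exec c (init_state w) t s ->
  exec (clear_regs (reg_bound c)) s (reg_bound c).+1
    (State (fun j => if j == 0 then reg s 0 else 0) (memory s)).
Proof.
move=> ex; have := exec_clear_regs (reg_bound c) s.
congr (exec _ _ _ (State _ _)); apply/funext => -[|j] //=.
by case: ltnP => // lt; rewrite (exec_reg_bound ex) ?leqW.
Qed.

Lemma runs_reduction : exists p, forall phi,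
  runs (cnf_size phi) reduction_cmd (init_state (encode_cnf3 phi))
    (init_state (encode_oa (reduce phi))) p.
Proof.
have [p0 h0] := runs_prelude; have [pa ha] := ev_adj.
suff [p hp] : exists p, forall phi, exists s',
    [/\ runs (cnf_size phi) reduction_body (init_state (encode_cnf3 phi)) s' p,
      reg s' 0 = cnf_order phi * cnf_order phi + 2
    & memory s' = memory (init_state (encode_oa (reduce phi)))].
  eexists => phi; have [s' [ex r0 mem]] := hp phi.
  have X1 := cnf_size_gt1 phi.
  apply: (runs_seq X1 ex (p2 := (reg_bound reduction_body).+1)).
  exists (reg_bound reduction_body).+1; last exact/ltnW/ltn_expl.
  have [t ex1 _] := ex; have := exec_clear_written ex1.
  by rewrite r0 mem init_encode_reduce.
eexists => phi; set X := cnf_size phi.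
have X1 : 1 < X := cnf_size_gt1 phi.
set w := encode_cnf3 phi; set N := cnf_order phi; set B := copy_base phi.
have [s1 [c1 m1 r0 [r3 r4 r5 r6 r7]]] := h0 phi.
have len : size w <= X ^ 2.
  rewrite size_encode_cnf3; have -> : X ^ 2 = X * X by [].
  by rewrite /X /cnf_size; nia.
have leN2 : N * N <= X ^ 10.
  by rewrite (expnD X 5 5); apply: leq_mul; apply: cnf_order_le.
have BE : B = N * N + 2 + size w by [].
have k1 := group_size_gt1 phi.
(* The original input lies within the output cells, hence is overwritten entirely. *)
have lenN : size w <= N * N + 2.
  rewrite size_encode_cnf3.
  have : size (clauses phi) + 3 <= N.
    by rewrite /N /cnf_order /order /off_constr /off_elem /off_forced; lia.
  nia.
have [] := @runs_fill X 8 s1 (evar 0) (evar 7) (fun j => eload (evar j))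
  (size w) B (nth 0 w) 1 2 1 (1 + 2) X1 _ len.
- exact: ev_varE.
- by move=> s' rg; apply: ev_varE; rewrite ?rg.
- move=> i s' lti rg mem ri.
  have -> : nth 0 w i = memory s' i by rewrite mem ?m1 //; lia.
  exact: (ev_load X1 (@ev_varE X 9 s' 8 _ X1 isT ri)).
move=> s2 [c2 rg2 m2].
have rd2 : ready phi 8 s2.
  split=> //; rewrite ?rg2 // => i lti; rewrite m2 -/B -addnS.
  rewrite ifT; last by rewrite size_encode_cnf3; lia.
  by rewrite addKn.
have [] := @runs_fill X 8 s2 (evar 6) (econst 2) eadj (N * N) 2
  (fun j => cnf_adj phi (j %/ N) (j %% N)) 1 10 0 pa X1 _ leN2.
- exact: (@ev_varE X 8 s2 6 _ X1 isT (ready_cells rd2)).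
- by move=> s' rg; apply: ev_const.
(* The saved copy lies beyond the matrix cells, so [ready] persists while they are filled. *)
- move=> i s' + rg mem ri; rewrite -ri => lti.
  apply: ha => //; case: rd2 => d0 d1 d2 d3 d4 d5 d6 d7.
  split; rewrite ?rg //.
  by move=> j ltj; rewrite mem ?d7 // -/B BE; lia.
move=> s3 [c3 rg3 m3].
have [] := @runs_fill X 8 s3 (evar 0) (evar 7) (fun=> econst 0)
  (size w) B (fun=> 0) 1 2 1 0 X1 _ len.
- by apply: ev_varE; rewrite ?rg3 ?rg2.
- by move=> s' rg; apply: ev_varE; rewrite ?rg ?rg3 ?rg2.
- by move=> i s' _ _ _ _; apply: ev_const.
move=> s4 [c4 rg4 m4].
have lek := group_size_le phi.
have [] := @runs_fill X 8 s4 (econst 2) (econst 0)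
  (fun j => eif (evar j) (emul (econst 4) (evar 4)) (evar 5))
  2 0 (fun i => if i == 0 then N else 4 * group_size phi) 0 1 0
  (1 + (0 + 1 + 2 + (2 + (1 + 0 + 2) + 4) + 2 + 1) + 2) X1 _ X1.
- exact: ev_const.
- by move=> s' rg; apply: ev_const.
- move=> i s' lti rg mem ri.
  have h4 : evaluates X (evar 4) 9 s' (group_size phi) 1.
    by apply: ev_varE => //; rewrite rg ?rg4 ?rg3 ?rg2.
  have h5 : evaluates X (evar 5) 9 s' N 1.
    by apply: ev_varE => //; rewrite rg ?rg4 ?rg3 ?rg2.
  apply: (ev_if X1 (@ev_varE X 9 s' 8 _ X1 isT ri)).
    move=> /negbTE ->; exact: (ev_mul X1 (@ev_const X 9 s' 4 X1) h4 lek).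
  by move=> ->.
move=> s5 [c5 rg5 m5].
have r65 : reg s5 6 = N * N by rewrite rg5 ?rg4 ?rg3 ?rg2.
have [s6 [c6 r8 a6]] := runs_assign
  (ev_add X1 (@ev_varE X 8 s5 6 _ X1 isT r65) (@ev_const X 8 s5 2 X1)).
exists (set_reg (set_reg s6 0 0) 0 (N * N + 2)); split.
- do 5!(apply: (runs_seq X1); first eassumption).
  apply: (runs_seq X1); first eassumption.
  exists (1 + 1); last exact: (X1 : 1 + 1 <= X ^ 1).
  by apply: ExecSeq; [exact: ExecConst | apply: exec_add; rewrite /= !updE /= r8].
- by rewrite /= updE.
- rewrite init_encode_reduce /= a6.2 m5 m4 m3 m2 m1; apply/funext => -[//|[//|a]].
  have -> : (0 <= a.+2 < 0 + 2) = false by [].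
  have -> : (a.+2 == 0) = false by [].
  have -> : (a.+2 == 1) = false by [].
  move: (N * N) BE lenN => M BE lenN.
  have -> : (2 <= a.+2 < 2 + M) = (a.+2 - 2 < M) by clear; lia.
  case: (ltnP (a.+2 - 2)) => h.
    by rewrite ifF // BE; move: h; clear; lia.
  case: ifP => [//|nB]; rewrite nB -[LHS]/(nth 0 w a.+2) nth_default //.
  apply: leq_trans lenN _.
  by move: h; clear; lia.
Qed.

(** * Running times *)

Lemma bit_size_le w : bit_size w <= \sum_(a <- w) a.+1.
Proof.
apply: leq_sum => a _; rewrite ltnS; case: a => // a.
by apply: leq_trans (ltnW (ltn_expl _ (ltnSn 1))) (trunc_logP _ _).
Qed.

Lemma size_le_bit_size w : size w <= bit_size w.
Proof. by rewrite -sum1_size; apply: leq_sum. Qed.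

Lemma bit_size_reduce_le phi :
  (bit_size (encode_oa (reduce phi))).+1 <= cnf_size phi ^ 12.
Proof.
apply: leq_trans (_ : (\sum_(a <- encode_oa (reduce phi)) a.+1).+1 <= _).
  by rewrite ltnS bit_size_le.
rewrite encode_reduce !big_cons big_map.
set N := cnf_order phi; set S := \sum_(i <- _) _.
(* Matrix entries are 0 or 1. *)
have leS : S <= 2 * (N * N).
  apply: leq_trans (_ : \sum_(i <- iota 0 (N * N)) 2 <= _).
    by apply: leq_sum => j _; case: cnf_adj.
  by rewrite big_const_seq count_predT size_iota iter_addn_0.
have := cnf_order_le phi; have := group_size_le phi; rewrite -/N.
have leX : 16 <= cnf_size phi by rewrite /cnf_size; lia.
move: (cnf_size phi) (group_size phi) leX => X k leX lek leN.
have le25 : X ^ 2 <= X ^ 10 by apply: leq_pexp2l; lia.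
have le50 : X ^ 5 <= X ^ 10 by apply: leq_pexp2l; lia.
have leNN : N * N <= X ^ 10 by rewrite (expnD X 5 5); apply: leq_mul.
have le0 : 0 < X ^ 10 by rewrite expn_gt0; lia.
rewrite (expnD X 2 10).
have le16 : 16 <= X ^ 2 by apply: leq_trans leX _; rewrite (leq_pexp2l _ (isT : 1 <= 2)); lia.
have := leq_mul le16 (leqnn (X ^ 10)).
move: (X ^ 10) (X ^ 5) (X ^ 2 * _) (N * N) le25 le50 leNN le0 lek leN leS.
move: (X ^ 2) => a b c d e; lia.
Qed.

(** With r = 4k = 2^(L+2), this bounds r log r linearly in n. For L >= 2, L+2 <= 4(L-1) and
    minimality of L give 32 (L-1) 2^(L-1) < 32n; the case L = 1 gives 24. *)
Lemma reduce_bound_le phi :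
  4 * group_size phi * (block (nvars phi) + 2) <= 32 * nvars phi + 24.
Proof.
rewrite /group_size; have [->|] := block_min (nvars phi); first by lia.
have := block_gt0 (nvars phi); case: (block (nvars phi)) => // -[|b] _.
  by move=> _; lia.
rewrite -[b.+2.-1]/b.+1 [2 ^ b.+2]expnS; set P := 2 ^ b.+1 => ltn.
have : P * (b.+2 + 2) <= P * (4 * b.+1) by apply: leq_mul => //; lia.
by move: ltn; clearbody P; rewrite [b.+1 * P]mulnC; nia.
Qed.

(** * Asymptotic estimates and the transfer of running times *)

Local Open Scope classical_set_scope.
Local Open Scope ring_scope.

(** With a small [eps], n+1 <= (1 + 1/eps)(1 + n eps) <= (1 + 1/eps) exp(n eps); raise this to the
    power [q]. Dividing by [q.+1] in [eps] covers q = 0. *)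
Lemma natr_pow_le_exp (R : realType) (delta : R) (q : nat) : 0 < delta ->
  exists2 C : R, 0 <= C &
    forall n : nat, n.+1%:R ^+ q <= C * 2 `^ (delta * n%:R).
Proof.
move=> d0; have l2 : 0 < ln (2 : R) by apply: ln_gt0; rewrite ltr1n.
pose eps := delta * ln 2 / q.+1%:R.
have e0 : 0 < eps by rewrite divr_gt0 ?mulr_gt0.
exists ((1 + eps^-1) ^+ q) => [|n].
  by rewrite exprn_ge0 // addr_ge0 // invr_ge0 ltW.
have le1 : n.+1%:R <= (1 + eps^-1) * expR (n%:R * eps).
  apply: le_trans (_ : (1 + eps^-1) * (1 + n%:R * eps) <= _).
    have -> : (1 + eps^-1) * (1 + n%:R * eps) = 1 + n%:R * eps + eps^-1 + n%:R.
      by field; rewrite gt_eqF.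
    rewrite -natr1.
    have : 0 <= n%:R * eps by rewrite mulr_ge0 // ltW.
    have : 0 <= eps^-1 by rewrite invr_ge0 ltW.
    lra.
  by rewrite ler_pM2l ?expR_ge1Dx // addr_gt0 // invr_gt0.
apply: le_trans (_ : ((1 + eps^-1) * expR (n%:R * eps)) ^+ q <= _).
  by rewrite lerXn2r // nnegrE // mulr_ge0 ?expR_ge0 // addr_ge0 // invr_ge0 ltW.
rewrite exprMn -expRM_natr /powR pnatr_eq0 /=.
apply: ler_wpM2l; first by rewrite exprn_ge0 // addr_ge0 // invr_ge0 ltW.
rewrite ler_expR.
have -> : delta * n%:R * ln 2 = n%:R * eps * q.+1%:R.
  have eE : eps * q.+1%:R = delta * ln 2 by rewrite /eps divfK ?pnatr_eq0.
  by rewrite -[RHS]mulrA eE; ring.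
by rewrite ler_wpM2l ?ler_nat // mulr_ge0 // ltW.
Qed.

(** Since r ln r <= 32n + 24, the little-o bound with factor [delta / 32] gives the claim for large
    r. *)
Lemma littleo_reduce_bound (R : realType) (f : nat -> R^o) (delta : R) : 0 < delta ->
  f =o_\oo (fun k : nat => k%:R * ln (k%:R : R) : R^o) ->
  exists2 C : R, 0 <= C &
    forall phi, f (oa_bound (reduce phi)) <= delta * (nvars phi)%:R + C.
Proof.
move=> d0 /eqoP fo.
pose eps := delta / 32.
have e0 : 0 < eps by rewrite divr_gt0.
have [K _ hK] := fo eps e0.
(* The sum absorbs the finitely many r below the threshold [K]. *)
exists (24 * eps + \sum_(i < K) `|f i|) => [|phi].
  by rewrite addr_ge0 ?sumr_ge0 // mulr_ge0 // ltW.
rewrite /=; set r := (4 * group_size phi)%N.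
have le_abs : f r <= `|f r| by apply: ler_norm.
have [ltr|ler] := ltnP r K.
  apply: le_trans le_abs _.
  apply: le_trans (_ : \sum_(i < K) `|f i| <= _).
    rewrite (bigD1 (Ordinal ltr)) //= lerDl; apply: sumr_ge0 => *; exact: normr_ge0.
  rewrite addrA lerDr addr_ge0 // mulr_ge0 // ltW //.
have := hK r ler; rewrite /= => hr.
have rE : r = (2 ^ (block (nvars phi) + 2))%N by rewrite /r /group_size expnD mulnC.
have l2 : 0 <= ln (2 : R) by apply: ln_ge0; rewrite ler1n.
have l21 : ln (2 : R) <= 1 by have := @le_ln1Dx R 1; apply; lra.
have rlnr : `|r%:R * ln (r%:R : R)| <= (32 * nvars phi + 24)%:R.
  rewrite {2}rE natrX lnXn // -[ln 2 *+ _]mulr_natl ger0_norm; last first.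
    by rewrite !mulr_ge0.
  apply: le_trans (_ : r%:R * (block (nvars phi) + 2)%:R <= _).
    by rewrite ler_wpM2l // ler_piMr.
  by rewrite -natrM ler_nat reduce_bound_le.
apply: le_trans le_abs (le_trans hr _).
apply: le_trans (_ : eps * (32 * nvars phi + 24)%:R <= _).
  by rewrite ler_wpM2l // ltW.
rewrite addrA; apply: le_trans (_ : delta * (nvars phi)%:R + 24 * eps <= _).
  rewrite natrD natrM mulrDr mulrA [eps * 24]mulrC.
  by rewrite /eps divfK ?pnatr_eq0.
by rewrite lerDl sumr_ge0.
Qed.

(** The number of variables is written in binary, so the scale need not be polynomial in the bit
    size; the factor n+1 is left to the exponential. *)
Lemma cnf_size_le phi :
  (cnf_size phi <= 16 * ((nvars phi).+1 * (bit_size (encode_cnf3 phi)).+1))%N.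
Proof.
have := size_le_bit_size (encode_cnf3 phi); rewrite size_encode_cnf3 /cnf_size.
by move: (bit_size _) (size _) => b m; move: (nvars phi) => n; nia.
Qed.

Lemma leq_expW m n e : (m <= n)%N -> (m ^ e <= n ^ e)%N.
Proof. by case: e => // e; rewrite leq_exp2r. Qed.

(** The reduction followed by the alliance algorithm decides 3-SAT. Half of [delta] pays for 2^f(r),
    the other half for the factors polynomial in n. *)
Theorem theorem3 (R : realType) :
  ETH R ->
  ~ exists2 f : nat -> R^o,
      f =o_\oo (fun k : nat => k%:R * ln (k%:R : R) : R^o) &
      solvable_Ostar (P := OffensiveAlliance)
        (fun x : oa_instance => 2 `^ (f (oa_bound x) : R)).
Proof.
move=> [delta d0 hard] [f fo [c [d solve]]]; apply: hard.
have d2 : 0 < delta / 2 by rewrite divr_gt0.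
have [p runs_red] := runs_reduction.
have [C0 C0_ge0 hf] := littleo_reduce_bound d2 fo.
(* [p] accounts for the reduction, and [12 * d] for the [d]-th power of the bit size of the reduced
   instance, which is at most [X ^ 12]. *)
pose q := (p + 12 * d)%N.
have [C1 C1_ge0 hC1] := natr_pow_le_exp q d2.
pose A : R := (1 + 2 `^ C0 * d%:R) * (16 ^ q)%:R * C1.
have A_ge0 : 0 <= A.
  by rewrite !mulr_ge0 // addr_ge0 // mulr_ge0 // powR_ge0.
(* One number serves as coefficient and as exponent, so it must dominate both [A] and [q]. *)
exists (Seq reduction_cmd c), (maxn q (Num.bound A)) => phi.
have [t1 ex1 le1] := runs_red phi.
have [t2 [s [ex2 le2 acc]]] := solve (reduce phi).
exists (t1 + t2)%N, s; split; first exact: ExecSeq ex1 ex2; last first.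
  by rewrite acc; apply: reduce_yes.
set X := cnf_size phi in le1; set n := nvars phi; set b := bit_size _.
set E : R := 2 `^ (delta / 2 * n%:R).
have E_ge1 : 1 <= E.
  by rewrite -(powRr0 2); apply: ler_powR; rewrite ?ler1n // mulr_ge0 // ltW.
have EE : 2 `^ (delta * n%:R) = E * E :> R.
  rewrite -powRD; last by rewrite pnatr_eq0 implybT.
  by congr powR; field.
have X0 : (0 < X)%N := ltnW (cnf_size_gt1 phi).
have leXq : (X ^ q)%:R <= (16 ^ q)%:R * (C1 * E) * b.+1%:R ^+ q :> R.
  apply: le_trans (_ : (16 ^ q)%:R * n.+1%:R ^+ q * b.+1%:R ^+ q <= _); last first.
    by rewrite ler_wpM2r ?exprn_ge0 // ler_wpM2l.
  by rewrite -!natrX -!natrM ler_nat -mulnA -!expnMn leq_expW ?cnf_size_le.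
have le1' : t1%:R <= E * (X ^ q)%:R.
  apply: le_trans (_ : (X ^ q)%:R <= _); last by rewrite ler_peMl.
  by rewrite ler_nat (leq_trans le1) // leq_pexp2l // leq_addr.
have le2' : t2%:R <= 2 `^ C0 * d%:R * (E * (X ^ q)%:R).
  apply: le_trans le2 _.
  apply: le_trans (_ : E * 2 `^ C0 * (d * X ^ q)%:R <= _); last first.
    by rewrite natrM le_eqVlt; apply/orP; left; apply/eqP; ring.
  apply: ler_pM; rewrite ?powR_ge0 //.
    rewrite -powRD; last by rewrite pnatr_eq0 implybT.
    by apply: ler_powR; rewrite ?ler1n.
  rewrite ler_nat leq_mul2l; apply/orP; right.
  apply: leq_trans (_ : (X ^ 12) ^ d <= _)%N.
    by rewrite leq_expW ?bit_size_reduce_le.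
  by rewrite -expnM leq_pexp2l // leq_addl.
rewrite natrD; apply: le_trans (lerD le1' le2') _.
rewrite -[X in X + _]mul1r -mulrDl.
apply: le_trans (_ : (1 + 2 `^ C0 * d%:R) *
    (E * ((16 ^ q)%:R * (C1 * E) * b.+1%:R ^+ q)) <= _).
  rewrite ler_wpM2l ?addr_ge0 ?mulr_ge0 ?powR_ge0 // ler_wpM2l //.
  exact: le_trans E_ge1.
have -> : (1 + 2 `^ C0 * d%:R) * (E * ((16 ^ q)%:R * (C1 * E) * b.+1%:R ^+ q)) =
    2 `^ (delta * n%:R) * (A * b.+1%:R ^+ q) :> R.
  by rewrite EE /A; ring.
rewrite ler_wpM2l ?powR_ge0 // natrM natrX.
apply: ler_pM; rewrite ?exprn_ge0 //.
  apply: le_trans (ltW (archi_boundP A_ge0)) _.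
  by rewrite ler_nat leq_maxr.
by rewrite ler_weXn2l ?ler1n // leq_maxl.
Qed.
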